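(* Let $1\leq p<2$. Let $\gamma:[0,1]\rightarrow\mathbb{R}^{2}$ be a continuous closed curve with finite $p$-variation. Then the first four terms of $\log(S(\gamma)_{0,1})$ (its components in $(\mathbb{R}^2)^{\otimes n}$, $n=1,2,3,4$) can be expressed in terms of the function $(x,y)\mapsto\eta(\gamma-\gamma_{0},(x,y))$ alone; that is, if $\gamma,\tilde\gamma:[0,1]\to\mathbb{R}^2$ are two continuous closed curves with finite $p$-variation such that $\eta(\gamma-\gamma_0,(x,y))=\eta(\tilde\gamma-\tilde\gamma_0,(x,y))$ for all $(x,y)$ outside the images of $\gamma-\gamma_0$ and $\tilde\gamma-\tilde\gamma_0$, then the components of degree $1,2,3,4$ of $\log(S(\gamma)_{0,1})$ and $\log(S(\tilde\gamma)_{0,1})$ coincide.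
   Context: Variation: a continuous $\gamma:[0,1]\to\mathbb{R}^2$ has finite $p$-variation if $\sup\sum_k|\gamma_{t_{k+1}}-\gamma_{t_k}|^p<\infty$, the supremum being over all finite partitions of $[0,1]$. The curve $\gamma$ is closed if $\gamma_0=\gamma_1$. Signature: $T((\mathbb{R}^2))$ is the algebra of sequences $(a_0,a_1,a_2,\ldots)$, $a_i\in(\mathbb{R}^2)^{\otimes i}$, with componentwise addition and product $\otimes$ whose $n$-th component is $\sum_{i=0}^n a_i\otimes b_{n-i}$. For $\gamma$ of finite $p$-variation, $1\le p<2$, the signature is $S(\gamma)_{0,1}=1+\sum_{n\ge1}\int_{0<t_1<\cdots<t_n<1}\mathrm{d}\gamma_{t_1}\otimes\cdots\otimes\mathrm{d}\gamma_{t_n}$ (Young integrals), and $\log$ is the formal logarithm in $T((\mathbb{R}^2))$. Winding number: for a continuous closed curve $\gamma$ and $z\in\mathbb{R}^2\setminus\gamma[0,1]$, $\eta(\gamma,z)=\frac1{2\pi}(\tilde g(1)-\tilde g(0))$, where $\tilde g:[0,1]\to\mathbb{R}$ is a continuous function with $e^{i\tilde g(s)}=(\gamma_s-z)/\|\gamma_s-z\|$ (identifying $\mathbb{R}^2$ with $\mathbb{C}$). *)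

(* Defs.v *)
From HB Require Import structures.
From mathcomp Require Import all_boot all_order all_algebra.
From mathcomp Require Import all_classical all_reals all_analysis.

Set Implicit Arguments.
Unset Strict Implicit.
Unset Printing Implicit Defensive.

Import Order.TTheory GRing.Theory Num.Theory.
Import numFieldNormedType.Exports.

Local Open Scope classical_set_scope.
Local Open Scope ring_scope.

(* A curve [0,1] -> R^2 is a function R -> 'rV[R]_2 of which only the values on
   `[0, 1] matter. *)

(* The library norm on 'rV[R]_2 is the sup norm; this is the Euclidean one. *)
Definition enorm (R : realType) (u : 'rV[R]_2) : R :=
  Num.sqrt (u 0 0 ^+ 2 + u 0 1 ^+ 2).

Definition pvariation_sum (R : realType) (p : R) (g : R -> 'rV[R]_2)
    (a b : R) (s : seq R) : R :=
  let t := nth b (a :: s) in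
  \sum_(0 <= k < size s) enorm (g (t k.+1) - g (t k)) `^ p.

(* In itv_partition a b s the list s omits the initial point a, so the points
   of the partition are those of a :: s. *)
Definition finite_pvariation (R : realType) (p : R) (g : R -> 'rV[R]_2)
    (a b : R) : Prop :=
  has_ubound [set pvariation_sum p g a b s | s in itv_partition a b].

Definition stieltjes_sum (R : realType) (f g : R -> R) (a b : R)
    (s : seq R) (xi : nat -> R) : R :=
  let t := nth b (a :: s) in
  \sum_(0 <= k < size s) f (xi k) * (g (t k.+1) - g (t k)).

(* l is the limit of the tagged Riemann-Stieltjes sums of f against g as the
   mesh of the partition tends to 0. *)
Definition is_young_integral (R : realType) (f g : R -> R) (a b l : R) : Prop :=
  forall e : R, 0 < e -> exists2 d : R, 0 < d &
    forall (s : seq R) (xi : nat -> R),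
      let t := nth b (a :: s) in
      itv_partition a b s ->
      (forall k, (k < size s)%N -> t k.+1 - t k < d) ->
      (forall k, (k < size s)%N -> t k <= xi k <= t k.+1) ->
      `|stieltjes_sum f g a b s xi - l| < e.

(* The value is 0 when the limit does not exist. *)
Definition young_integral (R : realType) (f g : R -> R) (a b : R) : R :=
  xget 0 [set l | is_young_integral f g a b l].

(* T((R^2)) in coordinates: a w, for a word w = i_1 ... i_n in the letters 0, 1,
   is the coefficient of e_{i_1} (x) ... (x) e_{i_n}, so the component of a in
   (R^2)^{(x) n} is the restriction of a to the words of length n. *)
Definition tensor_series (R : realType) : Type := seq 'I_2 -> R.

Definition tcomponent (R : realType) (n : nat) (a : tensor_series R) :
    {ffun n.-tuple 'I_2 -> R} :=
  [ffun w : n.-tuple 'I_2 => a w].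

Definition tone (R : realType) : tensor_series R := fun w => (w == [::])%:R.

Definition tsub (R : realType) (a b : tensor_series R) : tensor_series R :=
  fun w => a w - b w.

Definition tmul (R : realType) (a b : tensor_series R) : tensor_series R :=
  fun w => \sum_(i < (size w).+1) a (take i w) * b (drop i w).

Definition tpow (R : realType) (a : tensor_series R) (k : nat) :
    tensor_series R :=
  iter k (tmul a) (tone R).

(* log a = \sum_(k >= 1) (-1)^(k-1) / k (a - 1)^k, for a with constant term 1.
   By tpow_eq0 below, the terms with k > n do not contribute in degree n. *)
Definition tlog (R : realType) (a : tensor_series R) : tensor_series R :=
  fun w => \sum_(1 <= k < (size w).+1)
    (-1) ^+ k.-1 / k%:R * tpow (tsub a (tone R)) k w.

Lemma tpow_eq0 (R : realType) (a : tensor_series R) (k : nat) (w : seq 'I_2) :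
  a [::] = 0 -> (size w < k)%N -> tpow a k w = 0.
Proof.
move=> a0; elim: k w => [|k IHk] w // lt_wk.
rewrite /tpow /= -/(tpow a k) /tmul big1 // => -[[|i] lti] _ /=.
  by rewrite take0 a0 mul0r.
rewrite IHk ?mulr0 // size_drop.
case: w lt_wk lti => [|x w] //= lt_wk _.
by rewrite subSS (leq_ltn_trans (leq_subr _ _)).
Qed.

(* With w = i_n :: ... :: i_1 (last letter first), the integral over
   0 < t_1 < ... < t_n < t of dg^{i_1}_{t_1} ... dg^{i_n}_{t_n}. *)
Fixpoint iterated_integral (R : realType) (g : R -> 'rV[R]_2) (w : seq 'I_2)
    (t : R) : R :=
  if w is i :: w' then
    young_integral (iterated_integral g w') (fun u => g u 0 i) 0 t
  else 1.

Definition signature (R : realType) (g : R -> 'rV[R]_2) : tensor_series R :=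
  fun w => iterated_integral g (rev w) 1.

(* h is a continuous argument of g - z: e^(i h) = (g - z) / |g - z| on [0, 1],
   with R^2 identified with C by (x, y) |-> x + i y. *)
Definition is_angle_lift (R : realType) (g : R -> 'rV[R]_2) (z : 'rV[R]_2)
    (h : R -> R) : Prop :=
  {within `[0, 1], continuous h} /\
  forall s, s \in `[0, 1] ->
    cos (h s) = (g s - z) 0 0 / enorm (g s - z) /\
    sin (h s) = (g s - z) 0 1 / enorm (g s - z).

(* Meaningful for g continuous and closed and z outside g @` `[0, 1]. *)
Definition winding_number (R : realType) (g : R -> 'rV[R]_2) (z : 'rV[R]_2) :
    R :=
  xget 0 [set w | exists2 h, is_angle_lift g z h &
                  w = (h 1 - h 0) / (2 * pi)].

Definition translate_to_0 (R : realType) (g : R -> 'rV[R]_2) : R -> 'rV[R]_2 :=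
  fun t => g t - g 0.

(* Main.v *)
(* Write x, y for the coordinates of the curve. For a partition P of [0, 1] and
   a point z let D_P(z) be the crossing number of the rightward ray from z with
   the closed staircase path through the points of P. Then the Riemann-Stieltjes
   sum of F(x) against G(y) along P is the integral of D_P(z) F'(z_1) G'(z_2).
   Inserting a point into a partition changes D_P by the indicator function of a
   rectangle with sides |dx| and |dy|, so Young's estimate (sewing) bounds the
   L^1 norm of D_P - D_Q for Q finer than P by a quantity that tends to 0 with
   the mesh of P. Moreover D_Q is the winding number outside of small boxes
   around the pieces of the curve, of total area tending to 0. Hence for two
   curves with the same winding numbers D_P - D'_P tends to 0 in L^1, and the
   moments int F(x) dG(y) agree. In degree at most 4 the shuffle relations
   express the signature of a closed curve through such moments. *)

(* Degree 4 is where a count of unknowns stops matching: the logarithm of a signature lies in the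
   free Lie algebra on two letters, whose homogeneous parts have dimensions 1, 2, 3, 6 in degrees 2,
   3, 4, 5, while the winding number has n - 1 moments of total degree n - 2. The obstacle in the
   comparison is that nothing relates D_Q to the winding number inside the boxes, and that D_Q has
   no useful bound there. Inside the boxes only the coarse D_P is used, which is bounded by the
   number of points of P; hence P is chosen first, and Q is then made fine in terms of this number.
   All functions compared are step functions on a finite grid. Their L^1 norms are finite sums over
   its cells, and F' and G' become increments of F and G, for which a local Lipschitz bound is
   enough. *)
Require Import Defs.
From HB Require Import structures.
From mathcomp Require Import all_boot all_order all_algebra.
From mathcomp Require Import all_classical all_reals all_analysis.
From mathcomp Require Import ring lra.

Set Implicit Arguments.
Unset Strict Implicit.
Unset Printing Implicit Defensive.

Import Order.TTheory GRing.Theory Num.Theory.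
Import numFieldNormedType.Exports.

Local Open Scope classical_set_scope.
Local Open Scope ring_scope.

(** * Partitions, refinements and sums over consecutive points *)

Section PartitionSums.
Variable R : realType.
Implicit Types (a b s t u x : R) (P Q : seq R).

(** The values are not restricted to reals because J is also used with values in functions on the
    plane, for crossing numbers. Pieces are pairs of a [zip], so that later statements can quantify
    over them. *)
Definition psum (V : nmodType) (J : R -> R -> V) a P : V :=
  \sum_(c <- zip (a :: P) P) J c.1 c.2.

Lemma psum_nil (V : nmodType) (J : R -> R -> V) a : psum J a [::] = 0.
Proof. by rewrite /psum big_nil. Qed.

Lemma psum_cons (V : nmodType) (J : R -> R -> V) a x P :
  psum J a (x :: P) = J a x + psum J x P.
Proof. by rewrite /psum /= big_cons. Qed.

Lemma psum_cat (V : nmodType) (J : R -> R -> V) a P Q :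
  psum J a (P ++ Q) = psum J a P + psum J (last a P) Q.
Proof.
elim: P a => [|x P IHP] a; first by rewrite psum_nil add0r.
by rewrite cat_cons !psum_cons IHP addrA.
Qed.

Lemma psum_nth (V : nmodType) (J : R -> R -> V) a b P :
  psum J a P =
  \sum_(0 <= k < size P) J (nth b (a :: P) k) (nth b (a :: P) k.+1).
Proof.
elim: P a => [|x P IHP] a; first by rewrite psum_nil big_geq.
by rewrite psum_cons big_nat_recl // IHP.
Qed.

Lemma itv_partition_zip a b P c : itv_partition a b P ->
  c \in zip (a :: P) P -> [/\ a <= c.1, c.1 < c.2 & c.2 <= b].
Proof.
elim: P a => [|x P IHP] a //= PP.
have xb := itv_partition_le (itv_partition_cons PP).
have ax : a < x by case: PP => /andP[].
rewrite inE => /orP[/eqP -> //|/(IHP _ (itv_partition_cons PP))[xc cc cb]].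
by split=> //; exact: le_trans (ltW ax) xc.
Qed.

Lemma zip_partition_mem a P c : c \in zip (a :: P) P ->
  c.1 \in a :: P /\ c.2 \in a :: P.
Proof.
elim: P a => // x P IHP a; rewrite /= inE => /orP[/eqP ->|/IHP[c1 c2]].
  by rewrite /= !inE !eqxx orbT.
by rewrite !(in_cons a) c1 c2 !orbT.
Qed.

Lemma ler_psum (J K : R -> R -> R) a b P : itv_partition a b P ->
  (forall s t, a <= s -> s < t -> t <= b -> J s t <= K s t) ->
  psum J a P <= psum K a P.
Proof.
move=> PP JK; rewrite /psum big_seq [leRHS]big_seq.
by apply: ler_sum => c /(itv_partition_zip PP)[? ? ?]; exact: JK.
Qed.

Lemma ler_norm_psum (J : R -> R -> R) a P :
  `|psum J a P| <= psum (fun s t => `|J s t|) a P.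
Proof. exact: ler_norm_sum. Qed.

Lemma psum_telescope (V : zmodType) (f : R -> V) a P :
  psum (fun s t => f t - f s) a P = f (last a P) - f a.
Proof.
elim: P a => [|x P IHP] a; first by rewrite psum_nil subrr.
by rewrite psum_cons IHP addrC addrA subrK.
Qed.

Lemma itv_partition_ex a b : a <= b -> exists P, itv_partition a b P.
Proof.
rewrite le_eqVlt => /orP[/eqP <-|ab]; first by exists [::].
by exists [:: b]; exact: itv_partition1.
Qed.

Lemma itv_partition_rcons a b t P : itv_partition a b P -> b < t ->
  itv_partition a t (rcons P t).
Proof.
by move=> PP bt; rewrite -cats1;
  exact: itv_partition_cat PP (itv_partition1 bt).
Qed.

(** Inclusion of the sets of points would express the same idea; this form hands each piece of P its
    own partition, as inductions on P require. *)
Fixpoint refines a P Q : Prop :=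
  if P is x :: P' then
    exists Q1 Q2, [/\ Q = Q1 ++ Q2, itv_partition a x Q1 & refines x P' Q2]
  else Q = [::].

Lemma refines_mem a P Q s : refines a P Q -> s \in a :: P -> s \in a :: Q.
Proof.
elim: P a Q => [|x P IHP] a Q /=; first by move=> ->.
move=> [Q1 [Q2 [-> Q1P PQ2]]]; rewrite inE => /orP[/eqP ->|/(IHP _ _ PQ2)].
  by rewrite inE eqxx.
case: (Q1P) => _ /eqP <-; rewrite inE -cat_cons mem_cat => /orP[/eqP ->|->].
  by rewrite mem_last.
by rewrite orbT.
Qed.

(** The two lists are merged by induction on their total length: the smaller first point is taken,
    and the other list is restarted from it. *)
Lemma common_refinement a b P Q :
    itv_partition a b P -> itv_partition a b Q ->
  exists T, [/\ itv_partition a b T, refines a P T & refines a Q T].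
Proof.
elim: {P Q}_.+1 {-2}P {-2}Q (ltnSn (size P + size Q)) a => // n IHn.
case=> [|x P] [|y Q] ltn a PP QQ.
- by exists [::].
- by move: QQ; rewrite (itv_partition_nil PP) => /itv_partitionxx.
- by move: PP; rewrite (itv_partition_nil QQ) => /itv_partitionxx.
have PP' := itv_partition_cons PP; have QQ' := itv_partition_cons QQ.
have ax : a < x by case: PP => /andP[].
have ay : a < y by case: QQ => /andP[].
have cons_part z T : a < z -> itv_partition z b T -> itv_partition a b (z :: T).
  by move=> az; exact: (itv_partition_cat (itv_partition1 az)).
case: (ltgtP x y) => xy.
- have QQx : itv_partition x b (y :: Q).
    exact: itv_partition_cat (itv_partition1 xy) QQ'.
  have [|T [TT PT [Q1 [Q2 [TE Q1P Q2R]]]]] := IHn P (y :: Q) _ x PP' QQx.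
    by move: ltn; rewrite /= !addSn !ltnS.
  exists (x :: T); split; [exact: cons_part|by exists [:: x], T; split=> //;
    exact: itv_partition1|].
  exists (x :: Q1), Q2; split=> //; first by rewrite TE.
  exact: itv_partition_cat (itv_partition1 ax) Q1P.
- have PPy : itv_partition y b (x :: P).
    exact: itv_partition_cat (itv_partition1 xy) PP'.
  have [|T [TT [P1 [P2 [TE P1P P2R]]] QT]] := IHn (x :: P) Q _ y PPy QQ'.
    by move: ltn; rewrite /= !addSn !addnS !ltnS.
  exists (y :: T); split; [exact: cons_part| |by exists [:: y], T; split=> //;
    exact: itv_partition1].
  exists (y :: P1), P2; split=> //; first by rewrite TE.
  exact: itv_partition_cat (itv_partition1 ay) P1P.
- subst y.
  have [|T [TT PT QT]] := IHn P Q _ x PP' QQ'.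
    by move: ltn; rewrite /= !addSn !addnS !ltnS => /ltnW.
  exists (x :: T); split; first exact: cons_part.
    by exists [:: x], T; split=> //; exact: itv_partition1.
  by exists [:: x], T; split=> //; exact: itv_partition1.
Qed.

Lemma psum_refines_le (J K : R -> R -> R) a b P Q :
    (forall s t T, a <= s -> s <= t -> t <= b -> itv_partition s t T ->
      psum J s T <= K s t) ->
    itv_partition a b P -> refines a P Q -> psum J a Q <= psum K a P.
Proof.
elim: P a Q => [|x P IHP] a Q JK PP /=; first by move=> ->; rewrite !psum_nil.
move=> [Q1 [Q2 [-> Q1P PQ2]]].
have PP' := itv_partition_cons PP.
have ax : a < x by case: PP => /andP[].
have xb := itv_partition_le PP'.
rewrite psum_cat psum_cons; case: (Q1P) => _ /eqP ->; apply: lerD.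
  by apply: JK => //; exact: ltW.
apply: IHP => // s t T xs; apply: JK; exact: le_trans (ltW ax) xs.
Qed.

Lemma fine_partition a b d : a <= b -> 0 < d ->
  exists2 P, itv_partition a b P &
    forall c, c \in zip (a :: P) P -> c.2 - c.1 < d.
Proof.
move=> ab d0; have [n ltn] : exists n : nat, b - a < n%:R * (d / 2).
  exists (Num.truncn ((b - a) / (d / 2))).+1.
  have d2 : 0 < d / 2 by lra.
  by rewrite -ltr_pdivrMr // truncnS_gt // divr_ge0 ?subr_ge0 // ltW.
elim: n a ab ltn => [|n IHn] a ab; first by rewrite mul0r ltNge subr_ge0 ab.
rewrite -natr1 mulrDl mul1r => ltn; case: (ltP (b - a) d) => [bad|dba].
  move: ab; rewrite le_eqVlt => /orP[/eqP <-|ab]; first by exists [::].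
  by exists [:: b] => [|c]; [exact: itv_partition1|rewrite inE => /eqP ->].
have [||P PP Pd] := IHn (a + d / 2); [lra|lra|].
exists (a + d / 2 :: P).
  have ad : a < a + d / 2 by lra.
  exact: itv_partition_cat (itv_partition1 ad) PP.
by move=> c; rewrite inE => /orP[/eqP -> /=|/Pd //]; lra.
Qed.

End PartitionSums.

(** * Controls and the sewing estimate *)

Section Control.
Variable R : realType.
Implicit Types (a b s t u x : R) (P Q : seq R).

(** A control as in rough path theory: nonnegative, superadditive, and uniformly small near the
    diagonal. *)
Definition control (w : R -> R -> R) : Prop :=
  [/\ forall s t, 0 <= s -> s <= t -> t <= 1 -> 0 <= w s t,
      forall s u t, 0 <= s -> s <= u -> u <= t -> t <= 1 ->
        w s u + w u t <= w s t &
      forall e, 0 < e -> exists2 d, 0 < d &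
        forall s t, 0 <= s -> s <= t -> t <= 1 -> t - s < d -> w s t <= e].

(* The exponent r is the inverse of some q < 2 for which w bounds q-variations,
   so that cpow w r s t ^+ 2 = w s t `^ (2 / q) has an exponent above 1. *)
Definition cpow (w : R -> R -> R) (r s t : R) : R := w s t `^ r.

Variables (w : R -> R -> R) (r : R).
Hypotheses (wP : control w) (r_gt : 2^-1 < r).
Local Notation k := (cpow w r).
Local Notation k2 := (fun s t => k s t ^+ 2).

Let w_ge0 s t : 0 <= s -> s <= t -> t <= 1 -> 0 <= w s t.
Proof. by case: wP => + _ _; exact. Qed.

Let wD s u t : 0 <= s -> s <= u -> u <= t -> t <= 1 -> w s u + w u t <= w s t.
Proof. by case: wP => _ + _; exact. Qed.

Let r_ge0 : 0 <= r. Proof. by move: r_gt; lra. Qed.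

Lemma control_id s : 0 <= s -> s <= 1 -> w s s = 0.
Proof.
move=> s0 s1; have := w_ge0 s0 (lexx s) s1.
by have := wD s0 (lexx s) (lexx s) s1; lra.
Qed.

Lemma control_le s u v t : 0 <= s -> s <= u -> u <= v -> v <= t -> t <= 1 ->
  w u v <= w s t.
Proof.
move=> s0 su uv vt t1.
have ut := le_trans uv vt; have u0 := le_trans s0 su; have v1 := le_trans vt t1.
have := wD s0 su ut t1; have := wD u0 uv vt t1.
have := w_ge0 s0 su (le_trans ut t1); have := w_ge0 (le_trans u0 uv) vt t1.
lra.
Qed.

Lemma cpow_ge0 s t : 0 <= k s t. Proof. exact: powR_ge0. Qed.

Lemma cpow_le s u v t : 0 <= s -> s <= u -> u <= v -> v <= t -> t <= 1 ->
  k u v <= k s t.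
Proof.
move=> s0 su uv vt t1; rewrite ge0_ler_powR ?nnegrE ?control_le //.
  by rewrite w_ge0 // ?(le_trans s0) // (le_trans vt).
by rewrite w_ge0 // (le_trans su) // (le_trans uv).
Qed.

Definition half2 : R := (2^-1 `^ r) ^+ 2.

Lemma half2_lt : half2 < 2^-1.
Proof.
rewrite /half2 /powR gt_eqF ?invr_gt0 // -expRM_natl.
rewrite -[ltRHS]lnK ?posrE ?invr_gt0 // ltr_expR lnV ?posrE //.
have : 0 < ln (2 : R) by rewrite ln_gt0 // ltr1n.
move: r_gt; nra.
Qed.

Lemma cpow2_half s t u v : 0 <= u -> u <= v -> v <= 1 -> w u v <= w s t / 2 ->
  k u v ^+ 2 <= half2 * k s t ^+ 2.
Proof.
move=> u0 uv v1 wle; have w0 := w_ge0 u0 uv v1.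
rewrite /half2 -exprMn lerXn2r ?nnegrE ?mulr_ge0 ?cpow_ge0 ?powR_ge0 //.
rewrite -powRM ?invr_ge0 //; last by move: w0 wle; lra.
by rewrite ge0_ler_powR ?nnegrE // mulrC //; move: w0 wle; lra.
Qed.

Lemma cpow2E s t : k s t ^+ 2 = w s t `^ (r * 2).
Proof. by rewrite powRrM powR_mulrn // powR_ge0. Qed.

(** Since 2r > 1, this separates a factor that is superadditive from one that is monotone and tends
    to 0 with the length of the interval. *)
Lemma cpow2_mul s t : 0 <= w s t -> k s t ^+ 2 = w s t * w s t `^ (r * 2 - 1).
Proof.
move=> w0; rewrite cpow2E -[in RHS](powRr1 w0) -powRrM mul1r -powRD.
  by rewrite addrC subrK.
by rewrite addrC subrK gt_eqF // mulr_gt0 //; move: r_gt; lra.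
Qed.

Lemma cpow2D s u t : 0 <= s -> s <= u -> u <= t -> t <= 1 ->
  k s u ^+ 2 + k u t ^+ 2 <= k s t ^+ 2.
Proof.
move=> s0 su ut t1.
have st := le_trans su ut; have u0 := le_trans s0 su; have u1 := le_trans ut t1.
have wu := w_ge0 s0 su u1; have wt := w_ge0 u0 ut t1; have ws := w_ge0 s0 st t1.
rewrite !cpow2_mul //; apply:
  (@le_trans _ _ ((w s u + w u t) * w s t `^ (r * 2 - 1))).
  rewrite mulrDl lerD // ler_wpM2l // ge0_ler_powR ?nnegrE ?control_le //;
    by move: r_gt; lra.
by rewrite ler_wpM2r ?powR_ge0 ?wD.
Qed.

Lemma psum_cpow2 a b P : 0 <= a -> b <= 1 -> itv_partition a b P ->
  psum k2 a P <= k2 a b.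
Proof.
elim: P a => [|x P IHP] a a0 b1 PP.
  by rewrite psum_nil sqr_ge0.
have PP' := itv_partition_cons PP.
have ax : a <= x by case: PP => /andP[/ltW].
have xb := itv_partition_le PP'; have x0 := le_trans a0 ax.
rewrite psum_cons; apply: le_trans (cpow2D a0 ax xb b1).
by rewrite lerD2l IHP.
Qed.

Lemma psum_control a b P : 0 <= a -> b <= 1 -> itv_partition a b P ->
  psum w a P <= w a b.
Proof.
elim: P a => [|x P IHP] a a0 b1 PP.
  by rewrite psum_nil w_ge0 // (itv_partition_le PP).
have PP' := itv_partition_cons PP.
have ax : a <= x by case: PP => /andP[/ltW].
have xb := itv_partition_le PP'; have x0 := le_trans a0 ax.
by rewrite psum_cons; apply: le_trans (wD a0 ax xb b1); rewrite lerD2l IHP.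
Qed.

(** The source of all convergence: errors of size [k2] on each piece add up to something
    negligible. *)
Lemma psum_cpow2_mesh e : 0 < e -> exists2 d, 0 < d &
  forall a b P, 0 <= a -> b <= 1 -> itv_partition a b P ->
    (forall c, c \in zip (a :: P) P -> c.2 - c.1 < d) -> psum k2 a P <= e.
Proof.
move=> e0; have w01 : 0 <= w 0 1 by exact: w_ge0.
have e'0 : 0 < e / (w 0 1 + 1) by rewrite divr_gt0 // ltr_wpDl.
have q0 : 0 < r * 2 - 1 by move: r_gt; lra.
(* Below this threshold the factor w^(2r - 1) is at most e / (w 0 1 + 1), and the other factors sum
   to at most [w 0 1]. *)
case: wP => _ _ /(_ ((e / (w 0 1 + 1)) `^ (r * 2 - 1)^-1)); rewrite powR_gt0 //.
move=> /(_ isT)[d d0 wd]; exists d => // a b P a0 b1 PP mesh.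
have ab := itv_partition_le PP.
apply: le_trans (_ : psum (fun s t => e / (w 0 1 + 1) * w s t) a P <= _).
  rewrite /psum big_seq [leRHS]big_seq; apply: ler_sum => c cP.
  have [ac cc cb] := itv_partition_zip PP cP.
  have c0 := le_trans a0 ac; have c1 := le_trans cb b1; have cle := ltW cc.
  rewrite cpow2_mul ?w_ge0 // mulrC ler_wpM2r ?w_ge0 //.
  have := wd _ _ c0 cle c1 (mesh _ cP) => /(@ge0_ler_powR _ _ (ltW q0)).
  rewrite !nnegrE w_ge0 // powR_ge0 => /(_ isT isT).
  by rewrite -powRrM mulVf ?gt_eqF // powRr1 // ltW.
rewrite /psum -mulr_sumr -/(psum w a P).
apply: le_trans (_ : e / (w 0 1 + 1) * w 0 1 <= _).
  rewrite ler_wpM2l ?(ltW e'0) //.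
  by apply: le_trans (psum_control a0 b1 PP) _; exact: control_le.
by rewrite -mulrA ler_piMr ?(ltW e0) // mulrC ler_pdivrMr ?ltr_wpDl // mul1r
  lerDl.
Qed.

Lemma psum_cpow2_small a b e : 0 <= a -> a <= b -> b <= 1 -> 0 < e ->
  exists2 P, itv_partition a b P & psum k2 a P <= e.
Proof.
move=> a0 ab b1 /psum_cpow2_mesh[d d0 dP].
have [P PP /(dP _ _ _ a0 b1 PP)] := fine_partition ab d0.
by exists P.
Qed.

Lemma psum_cpow2_refines a b P Q : 0 <= a -> b <= 1 ->
  itv_partition a b P -> refines a P Q -> psum k2 a Q <= psum k2 a P.
Proof.
move=> a0 b1; apply: psum_refines_le => s t T sa st tb.
by apply: psum_cpow2; [exact: le_trans sa|exact: le_trans tb b1].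
Qed.

(** P1 is the initial run of points satisfying p; x is the first failure, or the final point when p
    never fails. *)
Lemma split_first (p : pred R) a P : P != [::] -> p a ->
  exists P1 x P2, [/\ P = P1 ++ x :: P2, p (last a P1) & P2 = [::] \/ ~~ p x].
Proof.
elim: P a => // x P IHP a _ pa.
case: (boolP (p x)) => px; last by exists [::], x, P; split=> //; right.
case: P IHP => [|y P] IHP; first by exists [::], x, [::]; split=> //; left.
have [//|//|P1 [z [P2 [-> pl zP]]]] := IHP x.
by exists (x :: P1), z, P2.
Qed.

(* Halving the control multiplies cpow ^+ 2 by at most half2 < 1/2, so the
   errors of the successive splittings form a geometric series. *)
Definition sewC : R := 2 / (1 - 2 * half2).

Lemma sewC_ge0 : 0 <= sewC.
Proof. by rewrite divr_ge0 // subr_ge0; have := half2_lt; lra. Qed.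

(* The defect of J is only needed at the points of the partitions: in the
   application to crossing numbers it is only known for points of a grid. *)
Variables (S : pred R) (V : zmodType) (N : V -> R) (J : R -> R -> V) (K : R).
Hypotheses (N0 : N 0 = 0) (ND : forall v v', N (v + v') <= N v + N v').
Hypotheses (K_ge0 : 0 <= K) (J_id : forall s, J s s = 0).
Hypothesis J_defect : forall s u t, S s -> S u -> S t ->
  0 <= s -> s <= u -> u <= t -> t <= 1 ->
  N (J s t - (J s u + J u t)) <= K * k s t ^+ 2.

Lemma sewing a b P : all S (a :: P) ->
  0 <= a -> b <= 1 -> itv_partition a b P ->
  N (J a b - psum J a P) <= sewC * K * k a b ^+ 2.
Proof.
elim: {P}_.+1 {-2}P (ltnSn (size P)) a b => // n IHn P ltn a b SP a0 b1 PP.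
have [PE|Pn0] := eqVneq P [::].
  rewrite PE psum_nil subr0 -(itv_partition_nil (eq_ind _ _ PP _ PE)).
  rewrite J_id N0; apply: mulr_ge0 (sqr_ge0 _); exact: mulr_ge0 sewC_ge0 K_ge0.
have ab := itv_partition_le PP.
have pa : w a a <= w a b / 2.
  by rewrite control_id ?divr_ge0 ?w_ge0 // (le_trans ab).
(* Split at the first point beyond half of the total control: both remaining
   parts have at most half of it. *)
have [P1 [x [P2 [PE]]]] :=
  split_first (p := fun u => w a u <= w a b / 2) Pn0 pa.
set y := last a P1 => wy xP.
move: PP ltn SP; rewrite PE size_cat /= addnS ltnS all_cat /=.
move=> PP ltn /and4P[Sa SP1 Sx SP2].
have Sy : S y by have := mem_last a P1;
  rewrite -/y inE => /orP[/eqP ->|/(allP SP1)].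
have Sb : S b.
  move: PP => [_]; rewrite last_cat /= => /eqP <-.
  by have := mem_last x P2; rewrite inE => /orP[/eqP ->|/(allP SP2)].
have [P1P yx P2P] : [/\ itv_partition a y P1, y < x & itv_partition x b P2].
  case: PP; rewrite cat_path /= last_cat /= -/y => /and3P[ay yx xb] xl.
  by split.
have ay := itv_partition_le P1P; have xb := itv_partition_le P2P.
have y0 := le_trans a0 ay; have ax := le_trans ay (ltW yx).
have x0 := le_trans a0 ax; have x1 := le_trans xb b1.
have y1 := le_trans (ltW yx) x1.
(* Either more than half of the control lies before x, and superadditivity leaves less than half, or
   x is b itself and the control vanishes. *)
have wx : w x b <= w a b / 2.
  case: xP => [P2E|]; last first.
    by rewrite -ltNge; have := wD a0 ax xb b1; lra.
  move: pa; rewrite -(itv_partition_nil (eq_ind _ _ P2P _ P2E)).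
  by rewrite !control_id // (le_trans ax).
have := IHn P1 (leq_ltn_trans (leq_addr _ _) ltn) a y.
rewrite /= Sa SP1 => /(_ isT a0 y1 P1P) H1.
have := IHn P2 (leq_ltn_trans (leq_addl _ _) ltn) x b.
rewrite /= Sx SP2 => /(_ isT x0 b1 P2P) H2.
have K1 := cpow2_half a0 ay y1 wy; have K2 := cpow2_half x0 xb b1 wx.
have D1 := J_defect Sa Sx Sb a0 ax xb b1.
have D2 := J_defect Sa Sy Sx a0 ay (ltW yx) x1.
have Kax : k a x ^+ 2 <= k a b ^+ 2.
  by rewrite lerXn2r ?nnegrE ?cpow_ge0 // cpow_le.
rewrite psum_cat psum_cons -/y.
have -> : J a b - (psum J a P1 + (J y x + psum J x P2)) =
    (J a b - (J a x + J x b)) + (J a x - (J a y + J y x)) +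
    ((J a y - psum J a P1) + (J x b - psum J x P2)).
  rewrite !opprD !addrA.
  by rewrite [RHS](ACl ((1*8*6*10)*(2*4)*(3*9)*(5*7)))%AC /= !addNr !addr0.
apply: le_trans (ND _ _) _; apply: le_trans (lerD (ND _ _) (ND _ _)) _.
apply: le_trans (lerD (lerD D1 D2) (lerD H1 H2)) _.
have C0 := sewC_ge0.
(* [sewC] is the solution C of C = 2 + 2 * half2 * C: two defects at this level, and one error for
   each half. *)
have -> : sewC * K * k a b ^+ 2 = K * k a b ^+ 2 + K * k a b ^+ 2 +
    (sewC * K * (half2 * k a b ^+ 2) + sewC * K * (half2 * k a b ^+ 2)).
  have h2 : 1 - 2 * half2 != 0 by rewrite gt_eqF // subr_gt0; have := half2_lt;
    lra.
  by rewrite /sewC; field.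
by rewrite lerD // lerD // ler_wpM2l // mulr_ge0.
Qed.
End Control.

(** * Young integration through local expansions *)

Section YoungPrimitive.
Variable R : realType.
Implicit Types (a b s t u x : R) (P Q : seq R) (f g h I : R -> R).
Variables (w : R -> R -> R) (r : R).
Hypotheses (wP : control w) (r_gt : 2^-1 < r).
Local Notation k := (cpow w r).
Local Notation k2 := (fun s t => k s t ^+ 2).

Section Refinement.
Variables (S : pred R) (V : zmodType) (N : V -> R) (J : R -> R -> V) (K : R).
Hypotheses (N0 : N 0 = 0) (ND : forall v v', N (v + v') <= N v + N v').
Hypotheses (K_ge0 : 0 <= K) (J_id : forall s, J s s = 0).
Hypothesis J_defect : forall s u t, S s -> S u -> S t ->
  0 <= s -> s <= u -> u <= t -> t <= 1 ->
  N (J s t - (J s u + J u t)) <= K * k s t ^+ 2.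

Lemma sewing_refines a b P Q : all S (a :: Q) -> 0 <= a -> b <= 1 ->
  itv_partition a b P -> refines a P Q ->
  N (psum J a P - psum J a Q) <= sewC r * K * psum k2 a P.
Proof.
elim: P a Q => [|x P IHP] a Q SQ a0 b1 PP.
  by move=> /= ->; rewrite !psum_nil subrr N0 mulr0.
move=> [Q1 [Q2 [QE Q1P PQ2]]]; move: SQ; rewrite QE /= all_cat.
move=> /and3P[Sa SQ1 SQ2].
have Sx : S x.
  case: (Q1P) => _ /eqP <-.
  by have := mem_last a Q1; rewrite inE => /orP[/eqP ->|/(allP SQ1)].
have PP' := itv_partition_cons PP.
have ax : a < x by case: PP => /andP[].
have xb := itv_partition_le PP'; have x0 := le_trans a0 (ltW ax).
rewrite psum_cat !psum_cons; case: (Q1P) => _ /eqP ->.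
rewrite opprD addrACA mulrDr; apply: le_trans (ND _ _) _; apply: lerD.
  apply: (sewing _ _ _ _ _ _ J_defect) => //; first by rewrite /= Sa.
  exact: le_trans xb b1.
by apply: IHP; rewrite //= Sx.
Qed.

End Refinement.

(** Regularity is measured by the control instead of the parameter; this is finite variation of
    exponent 1/r. *)
Definition holder f : Prop := exists2 K, 0 <= K &
  forall s t, 0 <= s -> s <= t -> t <= 1 -> `|f t - f s| <= K * k s t.

(* I is t |-> int_0^t f dg; the local expansion determines it uniquely. *)
Definition young_primitive f g I : Prop := I 0 = 0 /\ exists2 C, 0 <= C &
  forall s t, 0 <= s -> s <= t -> t <= 1 ->
    `|I t - I s - f s * (g t - g s)| <= C * k s t ^+ 2.

Lemma cpow_le1 s t : 0 <= s -> s <= t -> t <= 1 -> k s t <= k 0 1.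
Proof. by move=> s0 st t1; exact: (cpow_le wP r_gt). Qed.

Lemma holder_bounded f : holder f -> exists2 M, 0 <= M &
  forall t, 0 <= t -> t <= 1 -> `|f t| <= M.
Proof.
move=> [K K0 fK]; exists (`|f 0| + K * k 0 1).
  by rewrite addr_ge0 // mulr_ge0 // cpow_ge0.
move=> t t0 t1; rewrite -[f t](subrK (f 0)) addrC.
apply: le_trans (ler_normD _ _) _; rewrite lerD2l.
apply: le_trans (fK _ _ (lexx _) t0 t1) _.
by rewrite ler_wpM2l // cpow_le1.
Qed.

Lemma holder_cst c : holder (fun=> c).
Proof.
exists 0 => // s t _ _ _; by rewrite subrr normr0 mul0r.
Qed.

(** Increments of order [k2] sum to 0 along fine partitions. Every identity between Young integrals
    below is reduced to this by comparing local expansions. *)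
Lemma flat_constant f C : (forall s t, 0 <= s -> s <= t -> t <= 1 ->
  `|f t - f s| <= C * k s t ^+ 2) -> forall t, 0 <= t -> t <= 1 -> f t = f 0.
Proof.
move=> fC t t0 t1; apply/eqP; rewrite -subr_eq0 -normr_le0.
apply/ler_addgt0Pl => e e0; rewrite addr0.
have C1 : 0 < `|C| + 1 by rewrite ltr_wpDl.
have [P PP Pe] := psum_cpow2_small wP r_gt (lexx 0) t0 t1 (divr_gt0 e0 C1).
case: (PP) => _ /eqP {1}<-; rewrite -(psum_telescope f).
apply: le_trans (_ : psum (fun s t => `|C| * k s t ^+ 2) 0 P <= _).
  apply: le_trans (ler_norm_psum _ _ _) _; apply: (ler_psum PP) => s u s0 su ut.
  apply: le_trans (fC _ _ s0 (ltW su) (le_trans ut t1)) _.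
  by rewrite ler_wpM2r ?sqr_ge0 // ler_norm.
rewrite /psum -mulr_sumr; apply: le_trans (_ : `|C| * (e / (`|C| + 1)) <= _).
  by rewrite ler_wpM2l.
by rewrite mulrCA ler_piMr ?(ltW e0) // ler_pdivrMr // mul1r lerDl.
Qed.

Lemma young_defect f g s u t : f s * (g t - g s) -
  (f s * (g u - g s) + f u * (g t - g u)) = (f s - f u) * (g t - g u).
Proof. by ring. Qed.

Lemma young_defect_le f g K L s u t :
    (forall s t, 0 <= s -> s <= t -> t <= 1 -> `|f t - f s| <= K * k s t) ->
    (forall s t, 0 <= s -> s <= t -> t <= 1 -> `|g t - g s| <= L * k s t) ->
    0 <= K -> 0 <= L ->
    0 <= s -> s <= u -> u <= t -> t <= 1 ->
  `|f s - f u| * `|g t - g u| <= K * L * k s t ^+ 2.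
Proof.
move=> fK gL K0 L0 s0 su ut t1.
have u0 := le_trans s0 su; have u1 := le_trans ut t1.
rewrite distrC expr2 mulrACA; apply: ler_pM => //.
  apply: le_trans (fK _ _ s0 su u1) _.
  by rewrite ler_wpM2l // (cpow_le wP r_gt).
apply: le_trans (gL _ _ u0 ut t1) _.
by rewrite ler_wpM2l // (cpow_le wP r_gt).
Qed.

Lemma young_primitive_ex f g : holder f -> holder g ->
  exists I, young_primitive f g I.
Proof.
move=> [K K0 fK] [L L0 gL]; pose J s t := f s * (g t - g s).
have J_id s : J s s = 0 by rewrite /J subrr mulr0.
have J_defect s u t : predT s -> predT u -> predT t -> 0 <= s -> s <= u ->
  u <= t -> t <= 1 ->
    `|J s t - (J s u + J u t)| <= K * L * k s t ^+ 2.
  by move=> *; rewrite young_defect normrM; exact: young_defect_le.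
pose c := sewC r * (K * L).
have KL0 : 0 <= K * L by exact: mulr_ge0.
have c0 : 0 <= c by rewrite mulr_ge0 // sewC_ge0.
(* The integral is the supremum of the lower ends of the intervals with centre [psum J 0 P] and
   radius [c * psum k2 0 P]. A common refinement shows that any two of these intervals meet, so the
   supremum lies in all of them. *)
pose A t := [set psum J 0 P - c * psum k2 0 P | P in itv_partition 0 t].
have refP t P Q : t <= 1 -> itv_partition 0 t P -> refines 0 P Q ->
    `|psum J 0 P - psum J 0 Q| <= c * psum k2 0 P.
  move=> t1 PP PQ.
  apply: (sewing_refines _ _ _ _ J_defect _ _ t1 PP PQ) => //; last exact/allP.
    exact: normr0.
  exact: ler_normD.
have AP t P : t <= 1 -> itv_partition 0 t P ->
    ubound (A t) (psum J 0 P + c * psum k2 0 P).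
  move=> t1 PP _ [Q QQ <-]; have [T [_ PT QT]] := common_refinement PP QQ.
  have := refP _ _ _ t1 PP PT; have := refP _ _ _ t1 QQ QT.
  by rewrite !ler_norml => /andP[? ?] /andP[? ?]; lra.
pose I t := sup (A t).
have IP t P : t <= 1 -> itv_partition 0 t P ->
    `|I t - psum J 0 P| <= c * psum k2 0 P.
  move=> t1 PP; rewrite ler_distl; apply/andP; split.
    by apply: ub_le_sup; [exists (psum J 0 P + c * psum k2 0 P);
      exact: AP|exists P].
  by apply: ge_sup; [exists (psum J 0 P - c * psum k2 0 P), P|exact: AP].
exists I; split.
  have part0 : itv_partition (0 : R) 0 [::] by split=> /=.
  have := IP _ _ ler01 part0.
  by rewrite !psum_nil mulr0 subr0 normr_le0 => /eqP.
exists c => // s t s0; rewrite le_eqVlt => /orP[/eqP <-|st] t1.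
  by rewrite !subrr mulr0 subrr normr0 mulr_ge0 ?sqr_ge0.
apply/ler_addgt0Pl => e e0.
have c1 : 0 < c * 2 + 1 by rewrite ltr_wpDl // mulr_ge0.
have s1 := le_trans (ltW st) t1.
have [P PP Pe] := psum_cpow2_small wP r_gt (lexx 0) s0 s1 (divr_gt0 e0 c1).
(* Comparing P with P followed by t isolates [J s t]; P contributes its error twice, which is at
   most e by the choice of P. *)
have := IP _ _ t1 (itv_partition_rcons PP st).
rewrite -cats1 !psum_cat !psum_cons !psum_nil !addr0.
case: (PP) => _ /eqP ->; have := IP _ _ s1 PP.
have Ge : c * 2 * psum k2 0 P <= e.
  apply: le_trans (_ : c * 2 * (e / (c * 2 + 1)) <= _).
    by rewrite ler_wpM2l // mulr_ge0.
  by rewrite mulrCA ler_piMr ?(ltW e0) // ler_pdivrMr // mul1r lerDl.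
rewrite /J !ler_norml => /andP[? ?] /andP[? ?]; apply/andP; split; lra.
Qed.

Lemma eq_young_primitive f f' g g' I I' :
    (forall t, 0 <= t -> t <= 1 -> f t = f' t) ->
    (forall t, 0 <= t -> t <= 1 -> g t = g' t) ->
    (forall t, 0 <= t -> t <= 1 -> I t = I' t) ->
  young_primitive f g I -> young_primitive f' g' I'.
Proof.
move=> ff gg II [I0 [C C0 IC]]; split; first by rewrite -II.
exists C => // s t s0 st t1; have t0 := le_trans s0 st;
  have s1 := le_trans st t1.
by rewrite -!ff // -!gg // -!II ?IC.
Qed.

Lemma young_primitive_unique f g I I' :
  young_primitive f g I -> young_primitive f g I' ->
  forall t, 0 <= t -> t <= 1 -> I t = I' t.
Proof.
move=> [I0 [C C0 IC]] [I'0 [C' C'0 IC']] t t0 t1.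
have := @flat_constant (fun t => I t - I' t) (C + C').
rewrite I0 I'0 subr0 => H; apply/subr0_eq; apply: H => // s u s0 su u1.
have := IC _ _ s0 su u1; have := IC' _ _ s0 su u1.
rewrite !ler_norml mulrDl => /andP[? ?] /andP[? ?]; apply/andP; split; lra.
Qed.

Lemma holder_young_primitive f g I : holder f -> holder g ->
  young_primitive f g I -> holder I.
Proof.
move=> fH [L L0 gL] [_ [C C0 IC]]; have [M M0 fM] := holder_bounded fH.
have k0 : 0 <= k 0 1 by exact: cpow_ge0.
exists (M * L + C * k 0 1); first by rewrite addr_ge0 // mulr_ge0.
move=> s t s0 st t1; rewrite -[I t - I s](subrK (f s * (g t - g s))) addrC.
apply: le_trans (ler_normD _ _) _; rewrite normrM mulrDl.
apply: lerD; first by rewrite -mulrA ler_pM ?fM ?gL // (le_trans st).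
apply: le_trans (IC _ _ s0 st t1) _.
by rewrite -mulrA ler_wpM2l // expr2 ler_wpM2r ?cpow_ge0 // cpow_le1.
Qed.

Lemma young_primitiveD f f' g I I' :
  young_primitive f g I -> young_primitive f' g I' ->
  young_primitive (fun t => f t + f' t) g (fun t => I t + I' t).
Proof.
move=> [I0 [C C0 IC]] [I'0 [C' C'0 IC']].
split; first by rewrite I0 I'0 addr0.
exists (C + C'); first exact: addr_ge0.
move=> s t s0 st t1; have := IC _ _ s0 st t1; have := IC' _ _ s0 st t1.
rewrite !ler_norml mulrDl => /andP[? ?] /andP[? ?]; apply/andP; split; lra.
Qed.

Lemma young_primitive0 g : young_primitive (fun=> 0) g (fun=> 0).
Proof.
split=> //; exists 0 => // s t _ _ _.
by rewrite !mul0r !subr0 normr0.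
Qed.

Lemma young_primitive_sum (T : Type) (l : seq T) (F G : T -> R -> R) g :
  (forall i, young_primitive (F i) g (G i)) ->
  young_primitive (fun t => \sum_(i <- l) F i t) g
    (fun t => \sum_(i <- l) G i t).
Proof.
move=> FG; elim: l => [|i l IHl].
  by apply: eq_young_primitive (young_primitive0 g) => t _ _; rewrite ?big_nil.
by apply: eq_young_primitive (young_primitiveD (FG i) IHl) => t _ _;
  rewrite ?big_cons.
Qed.

(** An increment of the product minus both first-order terms is the product of the two increments,
    hence of order [k2]. *)
Lemma young_primitive_parts f g I I' : holder f -> holder g ->
  young_primitive f g I -> young_primitive g f I' ->
  forall t, 0 <= t -> t <= 1 -> f t * g t - f 0 * g 0 = I t + I' t.
Proof.
move=> [K K0 fK] [L L0 gL] [I0 [C C0 IC]] [I'0 [C' C'0 IC']] t t0 t1.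
have := @flat_constant (fun t => f t * g t - I t - I' t) (K * L + C + C').
move=> H; have /H/(_ t t0 t1) : forall s t, 0 <= s -> s <= t -> t <= 1 ->
    `|f t * g t - I t - I' t - (f s * g s - I s - I' s)| <=
    (K * L + C + C') * k s t ^+ 2; last by rewrite I0 I'0; lra.
move=> s u s0 su u1; have := IC _ _ s0 su u1; have := IC' _ _ s0 su u1.
have : `|(f u - f s) * (g u - g s)| <= K * L * k s u ^+ 2.
  by rewrite normrM expr2 mulrACA ler_pM ?fK ?gL.
rewrite !ler_norml !mulrDl => /andP[? ?] /andP[? ?] /andP[? ?].
apply/andP; split; lra.
Qed.

(** The expansion of h is substituted into that of I; the error of the former is multiplied by the
    bounded f. *)
Lemma young_primitive_assoc f g h I h' : holder f ->
  young_primitive g h' h -> young_primitive f h I ->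
  young_primitive (fun t => f t * g t) h' I.
Proof.
move=> fH [h0 [C C0 hC]] [I0 [D D0 ID]]; have [M M0 fM] := holder_bounded fH.
split=> //; exists (D + M * C); first by rewrite addr_ge0 // mulr_ge0.
move=> s t s0 st t1.
have -> : I t - I s - f s * g s * (h' t - h' s) =
    I t - I s - f s * (h t - h s) + f s * (h t - h s - g s * (h' t - h' s))
      by ring.
apply: le_trans (ler_normD _ _) _; rewrite mulrDl lerD ?ID //.
by rewrite normrM -mulrA ler_pM ?fM ?hC // (le_trans st).
Qed.

Lemma young_primitive_cst g : young_primitive (fun=> 1) g (fun t => g t - g 0).
Proof.
split; first by rewrite subrr.
exists 0 => // s t _ _ _; rewrite mul0r mul1r.
by have -> : g t - g 0 - (g s - g 0) - (g t - g s) = 0 by [ring];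
  rewrite normr0.
Qed.

End YoungPrimitive.

(** * Uniqueness of the limit of tagged sums *)

Lemma zip_partition_nth (R : realType) (a b : R) P c :
  c \in zip (a :: P) P ->
  exists2 k, (k < size P)%N &
    c = (nth b (a :: P) k, nth b (a :: P) k.+1).
Proof.
elim: P a => // x P IHP a.
rewrite /= inE => /orP[/eqP ->|/IHP[k ltk ->]]; first by exists 0%N.
by exists k.+1.
Qed.

Lemma nth_partition_zip (R : realType) (a b : R) P k : (k < size P)%N ->
  (nth b (a :: P) k, nth b (a :: P) k.+1) \in zip (a :: P) P.
Proof.
elim: P a k => // x P IHP a [|k] ltk; first by rewrite /= inE eqxx.
by rewrite /= inE -/(zip (x :: P) P) [X in _ || X]IHP ?orbT.
Qed.

Lemma is_young_integral_unique (R : realType) (f g : R -> R) a b l l' :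
  a <= b -> is_young_integral f g a b l -> is_young_integral f g a b l' ->
  l = l'.
Proof.
move=> ab lP l'P; apply/eqP; rewrite -subr_eq0 -normr_le0.
apply/ler_addgt0Pl => e e0; rewrite addr0.
have e2 : 0 < e / 2 by rewrite divr_gt0.
have [d d0 dP] := lP _ e2; have [d' d'0 d'P] := l'P _ e2.
have m0 : 0 < Num.min d d' by rewrite lt_min d0.
have [P PP mesh] := fine_partition ab m0.
have meshP k : (k < size P)%N ->
    nth b (a :: P) k.+1 - nth b (a :: P) k < Num.min d d'.
  by move=> /(nth_partition_zip a b)/mesh.
pose xi := nth b (a :: P).
have xiP k : (k < size P)%N -> xi k <= xi k <= xi k.+1.
  move=> ltk; rewrite lexx /=.
  have /itv_partition_zip : itv_partition a b P by [].
  by move/(_ _ (nth_partition_zip a b ltk)) => [_ /ltW].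
have H k (ltk : (k < size P)%N) : xi k.+1 - xi k < d /\ xi k.+1 - xi k < d'.
  by apply/andP; rewrite -lt_min; exact: meshP.
have := dP P xi PP (fun k ltk => (H k ltk).1) xiP.
have := d'P P xi PP (fun k ltk => (H k ltk).2) xiP.
rewrite !ltr_norml => /andP[? ?] /andP[? ?].
by rewrite ler_norml; apply/andP; split; lra.
Qed.

Lemma young_integralE (R : realType) (f g : R -> R) a b l :
  a <= b -> is_young_integral f g a b l -> young_integral f g a b = l.
Proof.
move=> ab lP; rewrite /young_integral; apply: xget_subset1 => //.
by move=> x y; exact: is_young_integral_unique.
Qed.

(** * Iterated integrals and the shuffle relations *)

Section IteratedIntegrals.
Variable R : realType.
Implicit Types (s t : R) (f h I : R -> R).
Variables (w : R -> R -> R) (r : R).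
Hypotheses (wP : control w) (r_gt : 2^-1 < r).
Local Notation k := (cpow w r).
Local Notation k2 := (fun s t => k s t ^+ 2).
Local Notation holder := (holder w r).
Local Notation young_primitive := (young_primitive w r).

(** Links the sewn integral with the limit over tagged partitions: moving a tag away from the left
    endpoint costs at most [K * L * k2] on its piece. *)
Lemma young_primitive_integral f h I : holder f -> holder h ->
  young_primitive f h I ->
  forall t, 0 <= t -> t <= 1 -> young_integral f h 0 t = I t.
Proof.
move=> [K K0 fK] [L L0 hL] [I0 [C C0 IC]] t t0 t1.
apply: young_integralE => // e e0.
have D0 : 0 <= C + K * L by rewrite addr_ge0 // mulr_ge0.
have D1 : 0 < C + K * L + 1 by rewrite ltr_wpDl.
have [d d0 dP] := psum_cpow2_mesh wP r_gt (divr_gt0 e0 D1).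
exists d => // P xi /= PP mesh xiP; set tt := nth t (0 :: P) in mesh xiP *.
have := dP 0 t P (lexx 0) t1 PP =>
  /(_ _)/wrap[c /(zip_partition_nth t)[m ltm ->]|Pe].
  exact: mesh.
have -> : I t = psum (fun s u => I u - I s) 0 P.
  by rewrite psum_telescope I0 subr0; case: (PP) => _ /eqP ->.
rewrite (psum_nth _ _ t) /stieltjes_sum -sumrB.
apply: le_lt_trans (_ : (C + K * L) * psum k2 0 P < _); last first.
  apply: le_lt_trans (ler_wpM2l D0 Pe) _.
  by rewrite mulrCA gtr_pMr // ltr_pdivrMr // mul1r ltrDl.
rewrite (psum_nth _ _ t) mulr_sumr; apply: le_trans (ler_norm_sum _ _ _) _.
rewrite big_nat_cond [leRHS]big_nat_cond.
apply: ler_sum => m; rewrite andbT => /andP[_ ltm]; rewrite -/tt.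
have [tm tm1] := andP (xiP m ltm).
have m0 : 0 <= tt m by rewrite (itv_partition_nth_ge _ PP) // ltnW.
have m1 : tt m.+1 <= 1 by apply: le_trans (itv_partition_nth_le _ PP) t1.
have tmm := le_trans tm tm1.
have E1 := IC _ _ m0 tmm m1.
have E2 : `|(f (xi m) - f (tt m)) * (h (tt m.+1) - h (tt m))| <=
  K * L * k2 (tt m) (tt m.+1).
  rewrite normrM expr2 mulrACA ler_pM ?hL //.
  apply: le_trans (fK _ _ m0 tm (le_trans tm1 m1)) _.
  by rewrite ler_wpM2l // (cpow_le wP r_gt).
move: E1 E2; rewrite !ler_norml mulrDl => /andP[? ?] /andP[? ?].
by apply/andP; split; lra.
Qed.

Variable g : R -> 'rV[R]_2.
Hypothesis gH : forall i, holder (fun u => g u 0 i).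
Local Notation T := (iterated_integral g).

(** Both claims go through one induction, since integrating once more needs the regularity of the
    previous integral. In particular the default value of [young_integral] never enters on
    [0, 1]. *)
Lemma iterated_integral_primitive u : holder (T u) /\
  forall i, young_primitive (T u) (fun s => g s 0 i) (T (i :: u)).
Proof.
have step v : holder (T v) ->
    forall i, young_primitive (T v) (fun s => g s 0 i) (T (i :: v)).
  move=> vH i; have [I IP] := young_primitive_ex wP r_gt vH (gH i).
  apply: (eq_young_primitive _ _ _ IP) => // t t0 t1.
  by rewrite /= (young_primitive_integral vH (gH i) IP).
elim: u => [|i u [uH uI]]; first by split;
  [exact: holder_cst|exact/step/holder_cst].
suff iuH : holder (T (i :: u)) by split=> //; exact: step.
exact: (holder_young_primitive wP r_gt uH (gH i) (uI i)).
Qed.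

(* As in iterated_integral, words are read from their last letter. *)
Definition letter_cons (i : 'I_2) (l : seq (seq 'I_2)) := [seq i :: u | u <- l].

(** The recursion shortens sometimes u and sometimes v, whence the inner fixpoint on v. *)
Fixpoint shuffle (u v : seq 'I_2) : seq (seq 'I_2) :=
  if u is i :: u' then
    (fix shuffle_u v := if v is j :: v' then
       letter_cons j (shuffle_u v') ++ letter_cons i (shuffle u' v)
     else [:: u]) v
  else [:: v].

Lemma shuffle_cons i u j v : shuffle (i :: u) (j :: v) =
  letter_cons j (shuffle (i :: u) v) ++ letter_cons i (shuffle u (j :: v)).
Proof. by []. Qed.

(** By associativity the integral against [T (j :: v)] is that of the product of [T u] and [T v]
    against coordinate j. The product formula is a hypothesis so that the induction for
    [shuffle_product] can use this lemma. *)
Lemma shuffle_primitive u j v I :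
    (forall t, 0 <= t -> t <= 1 ->
      T u t * T v t = \sum_(x <- shuffle u v) T x t) ->
    young_primitive (T u) (T (j :: v)) I ->
  forall t, 0 <= t -> t <= 1 ->
    I t = \sum_(x <- shuffle u v) T (j :: x) t.
Proof.
move=> uv uI; have [uH _] := iterated_integral_primitive u.
have [_ /(_ j) vI] := iterated_integral_primitive v.
have := young_primitive_assoc wP r_gt uH vI uI.
move=> /(eq_young_primitive uv (fun _ _ _ => erefl) (fun _ _ _ => erefl)) I1.
apply: (young_primitive_unique wP r_gt I1).
by apply: young_primitive_sum => x; have [_] := iterated_integral_primitive x.
Qed.

(** Integration by parts gives two integrals, according to which word supplies the outermost letter;
    each has a shorter product as integrand. *)
Lemma shuffle_product u v t : 0 <= t -> t <= 1 ->
  T u t * T v t = \sum_(x <- shuffle u v) T x t.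
Proof.
have [n ltn] := ubnP (size u + size v); elim: n u v ltn t => // n IHn.
case=> [|i u] v ltn t t0 t1; first by rewrite /= big_seq1 mul1r.
case: v ltn => [|j v] ltn; first by rewrite /= big_seq1 mulr1.
have [uH _] := iterated_integral_primitive (i :: u).
have [vH _] := iterated_integral_primitive (j :: v).
have [I IP] := young_primitive_ex wP r_gt uH vH.
have [I' I'P] := young_primitive_ex wP r_gt vH uH.
have := young_primitive_parts wP r_gt uH vH IP I'P t0 t1.
have [_ /(_ i)[T0 _]] := iterated_integral_primitive u.
rewrite T0 mul0r subr0 => ->.
rewrite shuffle_cons big_cat /letter_cons !big_map; congr (_ + _).
  apply: (shuffle_primitive _ IP) => // s s0 s1; apply: IHn => //.
  by move: ltn; rewrite /= addnS ltnS.
have vu s : 0 <= s -> s <= 1 ->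
    T (j :: v) s * T u s = \sum_(x <- shuffle u (j :: v)) T x s.
  by move=> s0 s1; rewrite mulrC; apply: IHn => //; move: ltn;
    rewrite /= addSn ltnS.
have [_ /(_ i) uI] := iterated_integral_primitive u.
have := young_primitive_assoc wP r_gt vH uI I'P.
move=> /(eq_young_primitive vu (fun _ _ _ => erefl) (fun _ _ _ => erefl)) I1.
have uI2 x : young_primitive (T x) (fun s => g s 0 i) (T (i :: x)).
  by have [_] := iterated_integral_primitive x.
exact: (young_primitive_unique wP r_gt I1 (young_primitive_sum _ uI2) t0 t1).
Qed.

End IteratedIntegrals.

(** * From finite p-variation to a control *)

Lemma segment_uniform_continuous (R : realType)
    (U : pseudoMetricNormedZmodType R) (f : R -> U) (a b : R) :
  {within `[a, b], continuous f} -> forall e, 0 < e ->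
  exists2 d, 0 < d & forall s t, a <= s -> s <= b -> a <= t -> t <= b ->
    `|t - s| < d -> `|f t - f s| <= e.
Proof.
move=> fc e e0; pose A := `[a, b]%classic.
pose P (d x : R) := forall y, A x -> A y -> `|y - x| < d -> `|f y - f x| <= e.
have /compact_near_coveringP covA : compact A by exact: segment_compact.
have : \forall d \near (0 : R)^'+, A `<=` P d.
  apply: covA => x Ax.
  have e2 : 0 < e / 2 by rewrite divr_gt0.
  have /subspace_continuousP/(_ x Ax) fx := fc.
  have /cvgrPdist_lt/(_ (e / 2) e2) := fx.
  rewrite near_withinE => /nbhs_ballP[eta /= eta0 H].
  have eta2 : 0 < eta / 2 by rewrite divr_gt0.
  near=> x' d => y Ax' Ay yx'.
  have xx' : `|x - x'| < eta / 2 by near: x'; exact: nbhsx_ballx.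
  have dd : d < eta / 2 by near: d; exact: nbhs_right_lt.
  have h1 := H x' _ Ax'; have h2 := H y _ Ay.
  have {}h1 : `|f x - f x'| < e / 2 by apply: h1; rewrite /ball /=; lra.
  have {}h2 : `|f x - f y| < e / 2.
    apply: h2; rewrite /ball /=; apply: le_lt_trans (ler_distD x' _ _) _.
    by rewrite (splitr eta) ltrD // distrC (lt_trans yx').
  rewrite (splitr e); apply: le_trans (ler_distD (f x) _ _) _.
  by rewrite lerD ?(ltW h1) // distrC ltW.
move=> AP; near (0 : R)^'+ => d.
have Pd : A `<=` P d by near: d.
exists d => [//|s t sa sb ta tb].
have As : A s by rewrite /A /= in_itv /= sa.
by apply: Pd => //; rewrite /A /= in_itv /= ta.
Unshelve. all: by end_near.
Qed.

Lemma le_enorm (R : realType) (u : 'rV[R]_2) i : `|u 0 i| <= enorm u.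
Proof.
rewrite /enorm -sqrtr_sqr ler_sqrt ?addr_ge0 ?sqr_ge0 //.
case: i => -[|[|//]] lti.
  by rewrite (_ : Ordinal lti = 0) ?lerDl ?sqr_ge0 //; exact: val_inj.
by rewrite (_ : Ordinal lti = 1) ?lerDr ?sqr_ge0 //; exact: val_inj.
Qed.

Lemma enorm_ge0 (R : realType) (u : 'rV[R]_2) : 0 <= enorm u.
Proof. exact: sqrtr_ge0. Qed.

Lemma enorm_le (R : realType) (u : 'rV[R]_2) : enorm u <= 2 * `|u|.
Proof.
have H i : `|u 0 i| <= `|u| by rewrite [leRHS]/Num.norm /= mx_normrE;
  exact: (le_bigmax _ (fun ij => `|u ij.1 ij.2|) (0, i)).
rewrite /enorm -[leRHS]ger0_norm ?mulr_ge0 // -sqrtr_sqr ler_sqrt ?sqr_ge0 //.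
rewrite -(real_normK (num_real (u 0 0))) -(real_normK (num_real (u 0 1))).
have := H 0; have := H 1; have := normr_ge0 (u 0 0); have := normr_ge0 (u 0 1).
nra.
Qed.

Section PVariationControl.
Variables (R : realType) (p : R) (g : R -> 'rV[R]_2).
Hypotheses (p_ge1 : 1 <= p) (p_lt2 : p < 2).
Hypotheses (g_cont : {within `[0, 1], continuous g}).
Hypothesis g_pvar : finite_pvariation p g 0 1.

Let D (x s t : R) : R := enorm (g t - g s) `^ x.

Let D_ge0 x s t : 0 <= D x s t. Proof. exact: powR_ge0. Qed.

Let psumD_ge0 x s P : 0 <= psum (D x) s P.
Proof. by apply: sumr_ge0 => c _; exact: D_ge0. Qed.

(** A partition of a subinterval is completed to one of [0, 1], which only adds nonnegative
    terms. *)
Lemma pvariation_bound : exists2 V, 0 <= V &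
  forall s t P, 0 <= s -> t <= 1 -> itv_partition s t P -> psum (D p) s P <= V.
Proof.
have [V VP] := g_pvar.
have VP' P : itv_partition 0 1 P -> psum (D p) 0 P <= V.
  by move=> PP; apply: VP; exists P => //; rewrite (psum_nth _ _ 1).
have [P0 P0P] := @itv_partition_ex R 0 1 ler01.
exists V; first by apply: le_trans (VP' _ P0P); exact: psumD_ge0.
move=> s t P s0 t1 PP.
have [P1 P1P] := itv_partition_ex s0; have [P2 P2P] := itv_partition_ex t1.
have := VP' _ (itv_partition_cat (itv_partition_cat P1P PP) P2P).
rewrite !psum_cat; case: (P1P) => _ /eqP ->; apply: le_trans.
by rewrite addrAC lerDr addr_ge0 ?psumD_ge0.
Qed.

(* The q-variation of a continuous curve of finite p-variation with p < q tends
   to 0 on small intervals, which is easier to see than for p itself. *)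
Let q : R := (p + 2) / 2.

Lemma qvariation_le V s t P e : 0 <= s -> t <= 1 -> itv_partition s t P ->
    psum (D p) s P <= V -> 0 <= e ->
    (forall u v, s <= u -> u <= v -> v <= t -> enorm (g v - g u) <= e) ->
  psum (D q) s P <= e `^ (q - p) * V.
Proof.
move=> s0 t1 PP PV e0 He.
apply: le_trans (ler_wpM2l (powR_ge0 _ _) PV).
rewrite /psum mulr_sumr -/(psum (fun s t => e `^ (q - p) * D p s t) s P).
apply: (ler_psum PP) => u v su uv vt; rewrite /D.
have qE : q = (q - p) + p by rewrite subrK.
have q0 : q != 0 by rewrite gt_eqF // /q; move: p_ge1; lra.
rewrite [in leLHS]qE powRD -?qE ?(negPf q0) //.
rewrite ler_wpM2r ?powR_ge0 // ge0_ler_powR ?nnegrE ?enorm_ge0 ?He ?(ltW uv) //.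
by rewrite /q; move: p_lt2; lra.
Qed.

Let var s t := sup [set psum (D q) s P | P in itv_partition s t].

Lemma pvariation_control : exists w : R -> R ->
  R, control w /\ forall i, holder w q^-1 (fun u => g u 0 i).
Proof.
have [V V0 VP] := pvariation_bound.
have p0 : 0 < p by exact: lt_le_trans p_ge1.
have q0 : 0 < q by rewrite /q; move: p_ge1; lra.
have qp0 : 0 < q - p by rewrite /q; move: p_lt2; lra.
(* A crude bound on all increments, to make the suprema in [var] finite. *)
have DV u v : 0 <= u -> u <= v -> v <= 1 -> enorm (g v - g u) <= V `^ p^-1.
  move=> u0; rewrite le_eqVlt => /orP[/eqP <-|uv] v1.
    by rewrite subrr /enorm !mxE expr0n /= addr0 sqrtr0 powR_ge0.
  have := VP u v [:: v] u0 v1 (itv_partition1 uv).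
  rewrite psum_cons psum_nil addr0 => /(@ge0_ler_powR _ p^-1).
  rewrite invr_ge0 (ltW p0) !nnegrE D_ge0 V0 => /(_ isT isT isT).
  by rewrite -powRrM mulfV ?gt_eqF // powRr1 ?enorm_ge0.
have varP s t P : 0 <= s -> t <= 1 -> itv_partition s t P ->
    psum (D q) s P <= var s t.
  move=> s0 t1 PP; apply: ub_le_sup; last by exists P.
  exists ((V `^ p^-1) `^ (q - p) * V) => _ [Q QQ <-].
  apply: (qvariation_le s0 t1 QQ) => //; [exact: VP t1 QQ|exact: powR_ge0|].
  by move=> u v su uv vt; apply: DV => //;
    [exact: le_trans su|exact: le_trans t1].
have var_le s t c : 0 <= s -> s <= t -> t <= 1 ->
    (forall P, itv_partition s t P -> psum (D q) s P <= c) -> var s t <= c.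
  move=> s0 st t1 H; apply: ge_sup; last by move=> _ [P PP <-]; exact: H.
  by have [P PP] := itv_partition_ex st; exists (psum (D q) s P), P.
exists var; split; last first.
  move=> i; exists 1 => // s t s0; rewrite le_eqVlt => /orP[/eqP <-|st] t1.
    by rewrite subrr normr0 mul1r powR_ge0.
  have -> : g t 0 i - g s 0 i = (g t - g s) 0 i by rewrite !mxE.
  rewrite mul1r; apply: le_trans (le_enorm _ _) _.
  have := varP s t [:: t] s0 t1 (itv_partition1 st).
  rewrite psum_cons psum_nil addr0 => Dv.
  have := Dv => /(@ge0_ler_powR _ q^-1).
  rewrite invr_ge0 (ltW q0) !nnegrE D_ge0 (le_trans (D_ge0 q s t) Dv).
  move=> /(_ isT isT isT).
  by rewrite -powRrM mulfV ?gt_eqF // powRr1 ?enorm_ge0.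
split.
- move=> s t s0 st t1; have [P PP] := itv_partition_ex st.
  exact: le_trans (psumD_ge0 q s P) (varP _ _ _ s0 t1 PP).
- move=> s u t s0 su ut t1; rewrite -lerBrDr.
  have u0 := le_trans s0 su; have u1 := le_trans ut t1.
  apply: (var_le) => // P PP; rewrite lerBrDr -lerBrDl.
  apply: (var_le) => // Q QQ; rewrite lerBrDl.
  have := varP _ _ _ s0 t1 (itv_partition_cat PP QQ).
  by rewrite psum_cat; case: (PP) => _ /eqP ->.
(* With x^(q - p) = e / (V + 1), increments of norm at most x have q-variation at most e. The
   modulus of continuity is taken for x / 2 because [enorm_le] loses a factor 2. *)
- move=> e e0; pose x := (e / (V + 1)) `^ (q - p)^-1.
  have V1 : 0 < V + 1 by rewrite ltr_wpDl.
  have x0 : 0 < x by rewrite powR_gt0 // divr_gt0.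
  have [d d0 dP] := segment_uniform_continuous g_cont (divr_gt0 x0 (ltr0n R 2)).
  exists d => // s t s0 st t1 std; apply: (var_le) => // P PP.
  apply: le_trans (qvariation_le s0 t1 PP (VP _ _ _ s0 t1 PP) (ltW x0) _) _.
    move=> u v su uv vt; apply: le_trans (enorm_le _) _.
    rewrite -ler_pdivlMl // mulrC; apply: dP.
    + exact: le_trans su.
    + exact: le_trans uv (le_trans vt t1).
    + exact: le_trans (le_trans s0 su) uv.
    + exact: le_trans t1.
    + by rewrite ger0_norm ?subr_ge0 //; lra.
  rewrite /x -powRrM mulVf ?gt_eqF // powRr1 ?divr_ge0 ?(ltW V1) ?(ltW e0) //.
  by rewrite -mulrA ler_piMr ?(ltW e0) // mulrC ler_pdivrMr // mul1r lerDl.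
Qed.

End PVariationControl.

(** Provides one control for both curves, as required to compare them along the same partitions. *)
Lemma controlD (R : realType) (w w' : R -> R -> R) : control w -> control w' ->
  control (fun s t => w s t + w' s t).
Proof.
move=> [w0 wD wS] [w'0 w'D w'S]; split.
- by move=> s t *; rewrite addr_ge0 ?w0 ?w'0.
- by move=> s u t *; rewrite addrACA lerD ?wD ?w'D.
- move=> e e0; have e2 : 0 < e / 2 by rewrite divr_gt0.
  have [d d0 dP] := wS _ e2; have [d' d'0 d'P] := w'S _ e2.
  exists (Num.min d d') => [|s t s0 st t1]; first by rewrite lt_min d0.
  rewrite lt_min => /andP[/(dP _ _ s0 st t1) ? /(d'P _ _ s0 st t1) ?]; lra.
Qed.

Lemma holder_control_le (R : realType) (w w' : R -> R -> R) r f :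
    0 <= r -> control w ->
    (forall s t, 0 <= s -> s <= t -> t <= 1 -> w s t <= w' s t) ->
  holder w r f -> holder w' r f.
Proof.
move=> r0 [w0 _ _] ww' [K K0 fK]; exists K => // s t s0 st t1.
apply: le_trans (fK _ _ s0 st t1) _; rewrite ler_wpM2l //.
by rewrite ge0_ler_powR ?nnegrE ?ww' ?w0 // (le_trans (w0 _ _ s0 st t1)) ?ww'.
Qed.

(** * Step functions and crossing numbers on a grid *)

Section Grid.
Variable R : realType.
Implicit Types (a s t u m alpha beta rho : R) (l P Q : seq R) (F G : R -> R).

(* Step functions whose jumps lie in a grid are integrated exactly by summing
   their values at the midpoints of the cells. *)
Definition midpoint (c : R * R) : R := (c.1 + c.2) / 2.

(** As alpha is a grid point, no cell straddles it, and the terms left of alpha telescope. The value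
    of b at alpha is left open, to serve strict and weak inequalities alike. *)
Lemma grid_telescope (b : pred R) F alpha a l :
    path <%R a l -> alpha \in a :: l ->
    (forall m, m < alpha -> b m) -> (forall m, alpha < m -> ~~ b m) ->
  \sum_(c <- zip (a :: l) l) (b (midpoint c))%:R * (F c.2 - F c.1) =
  F alpha - F a.
Proof.
move=> + + blt bgt; elim: l a => [|x l IHl] a al.
  by rewrite inE => /eqP ->; rewrite big_nil subrr.
have [aE _|aa] := eqVneq alpha a.
  rewrite aE subrr; apply: big1_seq => c /andP[_ cl].
  have PP : itv_partition a (last a (x :: l)) (x :: l) by split.
  have [ac cc _] := itv_partition_zip PP cl.
  rewrite (negPf (bgt _ _)) ?mul0r // aE /midpoint; move: ac cc; lra.
rewrite inE (negPf aa) /= => xl; move: al => /= /andP[ax al].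
have xa : x <= alpha.
  move: xl; rewrite inE => /orP[/eqP -> //|].
  by move/(allP (lt_path_min al))/ltW.
rewrite big_cons IHl // blt; last by rewrite /midpoint /=; lra.
by rewrite mul1r addrC addrA subrK.
Qed.

Lemma grid_of (V : seq R) : V != [::] ->
  exists a l, path <%R a l /\ a :: l =i V.
Proof.
case: V => // v V _; case E : (sort <=%R (undup (v :: V))) => [|a l].
  have : v \in sort <=%R (undup (v :: V))
    by rewrite mem_sort mem_undup inE eqxx.
  by rewrite E.
exists a, l; split.
  by have := undup_uniq (v :: V); rewrite -(sort_lt_sorted (undup (v :: V))) E.
by move=> u; rewrite -E mem_sort mem_undup.
Qed.

Lemma grid_ind_diff alpha beta a l : path <%R a l ->
    alpha \in a :: l -> beta \in a :: l ->
  \sum_(c <- zip (a :: l) l)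
    `|(midpoint c < alpha)%R%:R - (midpoint c < beta)%R%:R| * (c.2 - c.1) =
  `|alpha - beta|.
Proof.
move=> al; wlog ba : alpha beta / beta <= alpha.
  move=> H; case: (leP beta alpha) => [ba|/ltW ab]; first exact: H.
  move=> al1 bl1; rewrite distrC -H //; apply: eq_bigr => c _.
  by rewrite distrC.
move=> al1 bl1; rewrite ger0_norm ?subr_ge0 //.
have T1 := grid_telescope (b := fun m => m < alpha) id al al1.
have T2 := grid_telescope (b := fun m => m < beta) id al bl1.
have -> : alpha - beta = (alpha - a) - (beta - a) by ring.
rewrite -T1 => [|//|m /ltW]; last by rewrite -leNgt.
rewrite -T2 => [|//|m /ltW]; last by rewrite -leNgt.
rewrite -sumrB; apply: eq_bigr => c _.
rewrite -mulrBl; congr (_ * _); rewrite ger0_norm // subr_ge0 ler_nat.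
by case: ltP => // /lt_le_trans ->.
Qed.

Lemma grid_box alpha rho a l : path <%R a l -> 0 <= rho ->
    alpha - rho \in a :: l -> alpha + rho \in a :: l ->
  \sum_(c <- zip (a :: l) l) (`|midpoint c - alpha| <= rho)%R%:R * (c.2 - c.1) =
  2 * rho.
Proof.
move=> al r0 al1 bl1.
have T1 := grid_telescope (b := fun m => m <= alpha + rho) id al bl1.
have T2 := grid_telescope (b := fun m => m < alpha - rho) id al al1.
have -> : 2 * rho = (alpha + rho - a) - (alpha - rho - a) by ring.
rewrite -T1 => [|m /ltW //|m]; last by rewrite -ltNge.
rewrite -T2 => [|//|m /ltW]; last by rewrite -leNgt.
rewrite -sumrB; apply: eq_bigr => c _; rewrite -mulrBl; congr (_ * _).
rewrite ler_distl; case: (ltP (midpoint c) (alpha - rho)) => /= H.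
  by rewrite (_ : _ <= _) ?subrr //; lra.
by rewrite subr0.
Qed.

(* The contribution to the crossing number of the rightward ray from z of the
   vertical leg of the staircase (x s, y s), (x s, y t), (x t, y t). *)
Definition crossing (x y : R -> R) s t : R * R -> R := fun z =>
  ((z.2 < y t)%R%:R - (z.2 < y s)%R%:R) * (z.1 < x s)%R%:R.

(** Up to sign this is the indicator function of the rectangle between [x s], [x u] and [y u],
    [y t]. *)
Lemma crossing_defect x y s u t (z : R * R) :
  (crossing x y s t - (crossing x y s u + crossing x y u t)) z =
  ((z.2 < y t)%R%:R - (z.2 < y u)%R%:R) * ((z.1 < x s)%R%:R - (z.1 < x u)%R%:R).
Proof. by rewrite /crossing !fctE /=; ring. Qed.

Lemma psumE (J : R -> R -> R * R -> R) a P z :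
  psum J a P z = psum (fun s t => J s t z) a P.
Proof. by rewrite /psum fct_sumE. Qed.

Lemma crossing_le1 x y s t z : `|crossing x y s t z| <= 1.
Proof.
rewrite /crossing normrM; apply: le_trans (_ : 1 * 1 <= _);
  last by rewrite mulr1.
apply: ler_pM => //; last by rewrite normr_nat lern1 leq_b1.
rewrite ler_norml; case: (_ < _); case: (_ < _); rewrite /=; lra.
Qed.

Lemma psum_crossing_le x y a P z :
  `|psum (crossing x y) a P z| <= (size P)%:R.
Proof.
rewrite psumE; apply: le_trans (ler_norm_psum _ _ _) _.
elim: P a => [|u P IHP] a; first by rewrite psum_nil.
by rewrite psum_cons /= -add1n natrD lerD // crossing_le1.
Qed.

Section Cells.
Variables (a : R) (lx : seq R) (b : R) (ly : seq R).
Hypotheses (ax : path <%R a lx) (bY : path <%R b ly).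

Definition cells : seq ((R * R) * (R * R)) :=
  [seq (c, d) | c <- zip (a :: lx) lx, d <- zip (b :: ly) ly].

Definition cell_mid (e : (R * R) * (R * R)) : R * R :=
  (midpoint e.1, midpoint e.2).

Definition cell_area (e : (R * R) * (R * R)) : R :=
  (e.1.2 - e.1.1) * (e.2.2 - e.2.1).

Definition cell_norm (phi : R * R -> R) : R :=
  \sum_(e <- cells) `|phi (cell_mid e)| * cell_area e.

Lemma cells_prod (u v : R * R -> R) :
  \sum_(e <- cells) u e.1 * v e.2 =
  (\sum_(c <- zip (a :: lx) lx) u c) * (\sum_(d <- zip (b :: ly) ly) v d).
Proof. by rewrite big_distrlr /cells big_allpairs. Qed.

Lemma cell_grid e : e \in cells -> [/\ e.1.1 < e.1.2, e.2.1 < e.2.2,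
  [/\ e.1.1 \in a :: lx, e.1.2 \in a :: lx, e.2.1 \in b :: ly & e.2.2 \in b ::
    ly]
  & 0 <= cell_area e].
Proof.
move=> /allpairsP[[c d] /= [cl dl ->]] /=.
have PX : itv_partition a (last a lx) lx by split.
have PY : itv_partition b (last b ly) ly by split.
have [_ cc _] := itv_partition_zip PX cl;
  have [_ dd _] := itv_partition_zip PY dl.
have [c1 c2] := zip_partition_mem cl; have [d1 d2] := zip_partition_mem dl.
by split=> //; rewrite /cell_area mulr_ge0 // subr_ge0 ltW.
Qed.

Lemma cell_norm0 : cell_norm 0 = 0.
Proof. by apply: big1 => e _; rewrite normr0 mul0r. Qed.

Lemma cell_norm_le phi psi : (forall z, `|phi z| <= psi z) ->
  cell_norm phi <= \sum_(e <- cells) psi (cell_mid e) * cell_area e.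
Proof.
move=> H; rewrite /cell_norm big_seq [leRHS]big_seq.
by apply: ler_sum => e /cell_grid[_ _ _ e0]; rewrite ler_wpM2r.
Qed.

Lemma cell_normD phi psi : cell_norm (phi + psi) <=
  cell_norm phi + cell_norm psi.
Proof.
rewrite {2 3}/cell_norm -big_split /=.
under [leRHS]eq_bigr do rewrite -mulrDl.
apply: (cell_norm_le (psi := fun z => `|phi z| + `|psi z|)) => z.
exact: ler_normD.
Qed.

Lemma cell_normB phi psi : cell_norm (phi - psi) = cell_norm (psi - phi).
Proof. by apply: eq_bigr => e _; rewrite -opprB normrN. Qed.

Lemma cell_norm_defect x y s u t :
    x s \in a :: lx -> x u \in a :: lx -> y u \in b :: ly -> y t \in b :: ly ->
  cell_norm (crossing x y s t - (crossing x y s u + crossing x y u t)) =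
  `|x s - x u| * `|y t - y u|.
Proof.
move=> xs xu yu yt; rewrite -(grid_ind_diff ax xs xu) -(grid_ind_diff bY yt yu).
rewrite -cells_prod; apply: eq_bigr => e _.
by rewrite crossing_defect normrM /cell_area /=; ring.
Qed.

Lemma cell_box alpha beta rho : 0 <= rho ->
    alpha - rho \in a :: lx -> alpha + rho \in a :: lx ->
    beta - rho \in b :: ly -> beta + rho \in b :: ly ->
  \sum_(e <- cells) ((`|(cell_mid e).1 - alpha| <= rho)
    && (`|(cell_mid e).2 - beta| <= rho))%:R * cell_area e = 4 * rho ^+ 2.
Proof.
move=> r0 a1 a2 b1 b2.
have -> : 4 * rho ^+ 2 = (2 * rho) * (2 * rho) by ring.
rewrite -{1}(grid_box ax r0 a1 a2) -(grid_box bY r0 b1 b2) -cells_prod.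
by apply: eq_bigr => e _; rewrite -mulnb natrM /cell_area /=; ring.
Qed.

(** The discrete Green formula for one vertical leg. The grid starts at a, so F appears relative to
    its value there. *)
Lemma cell_stieltjes F G x y s t :
    x s \in a :: lx -> y s \in b :: ly -> y t \in b :: ly ->
  \sum_(e <- cells) crossing x y s t (cell_mid e) *
    ((F e.1.2 - F e.1.1) * (G e.2.2 - G e.2.1)) =
  (F (x s) - F a) * (G (y t) - G (y s)).
Proof.
move=> xs ys yt.
have le_lt c m : c < m -> ~~ (m < c) by move=> /ltW; rewrite -leNgt.
rewrite -(grid_telescope (b := fun m => m < x s) F ax xs) //; last by move=> m;
  exact: le_lt.
have -> : G (y t) - G (y s) = (G (y t) - G b) - (G (y s) - G b) by ring.
rewrite -(grid_telescope (b := fun m => m < y t) G bY yt) //; last by move=> m;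
  exact: le_lt.
rewrite -(grid_telescope (b := fun m => m < y s) G bY ys) //; last by move=> m;
  exact: le_lt.
rewrite -sumrB -cells_prod; apply: eq_bigr => e _.
by rewrite /crossing /=; ring.
Qed.

End Cells.

End Grid.

(** * Comparing the crossing numbers of two curves *)

Section GreenComparison.
Variable R : realType.
Implicit Types (s t u m M : R) (P Q : seq R) (F G : R -> R).
Variables (w : R -> R -> R) (r K : R).
Hypotheses (wP : control w) (r_gt : 2^-1 < r) (K_ge0 : 0 <= K).
Local Notation k := (cpow w r).
Local Notation k2 := (fun s t => k s t ^+ 2).

Definition holder_by (f : R -> R) : Prop :=
  forall s t, 0 <= s -> s <= t -> t <= 1 -> `|f t - f s| <= K * k s t.

(* By holder_by, the curve stays in the box on the whole of [c.1, c.2]. *)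
Definition in_box (x y : R -> R) (c z : R * R) : bool :=
  (`|z.1 - x c.1| <= K * k c.1 c.2) && (`|z.2 - y c.1| <= K * k c.1 c.2).

(** The coordinates at which a crossing number or the indicator function of a box can jump. *)
Definition box_points (f : R -> R) Q : seq R :=
  [seq f s | s <- 0 :: Q] ++
  [seq f c.1 - K * k c.1 c.2 | c <- zip (0 :: Q) Q] ++
  [seq f c.1 + K * k c.1 c.2 | c <- zip (0 :: Q) Q].

Lemma box_pointsP f Q : 
  (forall s, s \in 0 :: Q -> f s \in box_points f Q) /\
  (forall c, c \in zip (0 :: Q) Q ->
    f c.1 - K * k c.1 c.2 \in box_points f Q /\
    f c.1 + K * k c.1 c.2 \in box_points f Q).
Proof.
split=> [s sQ|c cQ]; first by rewrite mem_cat map_f.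
split; rewrite !mem_cat; apply/or3P.
  apply: Or32; exact: (map_f (fun c => f c.1 - K * k c.1 c.2)).
apply: Or33; exact: (map_f (fun c => f c.1 + K * k c.1 c.2)).
Qed.

(** Bounds the grid independently of Q, so that one Lipschitz constant serves all cells. *)
Lemma box_points_le f Q M : itv_partition 0 1 Q ->
    (forall t, 0 <= t -> t <= 1 -> `|f t| <= M) ->
  forall v, v \in box_points f Q -> `|v| <= M + K * k 0 1.
Proof.
move=> QQ fM v.
have Kk0 : 0 <= K * k 0 1 by rewrite mulr_ge0 // cpow_ge0.
have bnd c e : c \in zip (0 :: Q) Q -> `|e| <= K * k c.1 c.2 ->
  `|f c.1 + e| <= M + K * k 0 1.
  move=> /(itv_partition_zip QQ)[c0 cc c1] eK.
  apply: le_trans (ler_normD _ _) _; apply: lerD.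
    by rewrite fM // (le_trans (ltW cc)).
  apply: le_trans eK _; rewrite ler_wpM2l // (cpow_le1 wP r_gt) //; exact: ltW.
have nrm c : `|K * k c.1 c.2| <= K * k c.1 c.2.
  by rewrite ger0_norm // mulr_ge0 // cpow_ge0.
rewrite !mem_cat => /or3P[] /mapP[c cQ ->].
- apply: le_trans (fM _ _ _) _; last by rewrite lerDl.
    by move: cQ; rewrite inE => /orP[/eqP ->|] //;
      case: QQ => /lt_path_min/allP QQ _ /QQ/ltW.
  move: cQ; rewrite inE => /orP[/eqP -> //|cQ].
  have := itv_partition_nth_le _ QQ => /(_ (index c Q).+1).
  by rewrite /= nth_index // ltnS index_mem; exact.
- by apply: bnd; rewrite ?normrN.
- exact: bnd.
Qed.

Section FixedPartitions.
Variables (x y x' y' : R -> R) (P Q : seq R).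
Hypotheses (xK : holder_by x) (yK : holder_by y).
Hypotheses (x'K : holder_by x') (y'K : holder_by y').
Hypothesis PP : itv_partition 0 1 P.
Hypothesis PQ : refines 0 P Q.
Variables (a : R) (lx : seq R) (b : R) (ly : seq R).
Hypotheses (ax : path <%R a lx) (bY : path <%R b ly).
Hypotheses (gx : a :: lx =i box_points x Q ++ box_points x' Q).
Hypotheses (gy : b :: ly =i box_points y Q ++ box_points y' Q).
Local Notation N := (cell_norm a lx b ly).

Let S : pred R := fun s => [&& x s \in a :: lx, y s \in b :: ly,
  x' s \in a :: lx & y' s \in b :: ly].

Let SQ : all S (0 :: Q).
Proof.
apply/allP => s sQ; rewrite /S !gx !gy ![_ \in _ ++ box_points _ _]mem_cat.
have H f := proj1 (box_pointsP f Q) s sQ.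
by rewrite !H !orbT.
Qed.

(** Sewing applied to the function-valued J given by [crossing]: the norm of its defect is the area
    of a rectangle, which has Young's bound. *)
Lemma cell_norm_refines (u v : R -> R) : holder_by u -> holder_by v ->
    (forall s, S s -> u s \in a :: lx /\ v s \in b :: ly) ->
  N (psum (crossing u v) 0 P - psum (crossing u v) 0 Q) <=
  sewC r * (K * K) * psum k2 0 P.
Proof.
move=> uK vK uv.
have J_defect s t1 t : S s -> S t1 -> S t -> 0 <= s -> s <= t1 -> t1 <= t ->
  t <= 1 ->
    N (crossing u v s t - (crossing u v s t1 + crossing u v t1 t)) <=
    K * K * k s t ^+ 2.
  move=> /uv[us vs] /uv[ut1 vt1] /uv[ut vt] s0 st1 t1t tle.
  by rewrite cell_norm_defect //; exact: (young_defect_le wP r_gt uK vK).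
apply: (sewing_refines wP r_gt _ _ _ _ J_defect SQ _ _ PP PQ) => //.
- exact: cell_norm0.
- by move=> phi psi; exact: cell_normD.
- exact: mulr_ge0.
- by move=> s; apply: funext => z; rewrite /crossing subrr mul0r.
Qed.

Hypothesis same_crossing : forall z,
  (forall c, c \in zip (0 :: Q) Q -> ~~ in_box x y c z) ->
  (forall c, c \in zip (0 :: Q) Q -> ~~ in_box x' y' c z) ->
  psum (crossing x y) 0 Q z = psum (crossing x' y') 0 Q z.

Lemma cell_norm_compare :
  N (psum (crossing x y) 0 P - psum (crossing x' y') 0 P) <=
  4 * (sewC r * (K * K)) * psum k2 0 P +
  16 * (K * K) * (size P)%:R * psum k2 0 Q.
Proof.
set DP := psum (crossing x y) 0 P; set DQ := psum (crossing x y) 0 Q.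
set DP' := psum (crossing x' y') 0 P; set DQ' := psum (crossing x' y') 0 Q.
have E1 : N (DP - DQ) <= sewC r * (K * K) * psum k2 0 P.
  by apply: cell_norm_refines => // s /and4P[].
have E2 : N (DP' - DQ') <= sewC r * (K * K) * psum k2 0 P.
  by apply: cell_norm_refines => // s /and4P[].
(* Counts the boxes of both curves that contain z. Each box has area 4 K^2 [k2], whence the constant
   8 in [boxN]. *)
pose box z : R := \sum_(c <- zip (0 :: Q) Q)
  ((in_box x y c z)%:R + (in_box x' y' c z)%:R).
have box_ge0 z : 0 <= box z by apply: sumr_ge0 => c _;
  rewrite addr_ge0 // ler0n.
have boxN : \sum_(e <- cells a lx b ly) box (cell_mid e) * cell_area e =
    8 * (K * K) * psum k2 0 Q.
  transitivity (\sum_(c <- zip (0 :: Q) Q) \sum_(e <- cells a lx b ly)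
    ((in_box x y c (cell_mid e))%:R + (in_box x' y' c (cell_mid e))%:R) *
      cell_area e).
    by rewrite exchange_big; apply: eq_bigr => e _; rewrite /box mulr_suml.
  rewrite /psum mulr_sumr; apply: eq_big_seq => c cQ.
  under eq_bigr do rewrite mulrDl.
  have H f := proj2 (box_pointsP f Q) c cQ.
  rewrite big_split /= !cell_box ?gx ?gy ?[_ \in _ ++ box_points _ _]mem_cat
    ?mulr_ge0 ?cpow_ge0 //;
    rewrite ?(proj1 (H _)) ?(proj2 (H _)) ?orbT //.
  by ring.
(* Pointwise: off the boxes DQ and DQ' agree; inside, the detour through DP and DP' leaves DP - DP',
   which is at most twice the size of P. *)
have E3 : N (DQ - DQ') <= N (DP - DQ) + N (DP' - DQ') +
    16 * (K * K) * (size P)%:R * psum k2 0 Q.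
  have -> : 16 * (K * K) * (size P)%:R * psum k2 0 Q =
     2 * (size P)%:R * (8 * (K * K) * psum k2 0 Q) by ring.
  rewrite -boxN mulr_sumr /cell_norm -!big_split /=.
  under [leRHS]eq_bigr do rewrite -mulrDl mulrA -mulrDl.
  apply: (cell_norm_le ax bY
    (psi := fun z => `|(DP - DQ) z| + `|(DP' - DQ') z| +
    2 * (size P)%:R * box z)) => z.
  have [z0|] := boolP [forall i : 'I_(size (zip (0 :: Q) Q)),
    ~~ in_box x y (nth (0, 0) (zip (0 :: Q) Q) i) z &&
    ~~ in_box x' y' (nth (0, 0) (zip (0 :: Q) Q) i) z].
    have -> : (DQ - DQ') z = 0.
      rewrite !fctE; apply/eqP; rewrite subr_eq0; apply/eqP.
      apply: same_crossing => c /(nthP (0, 0))[i ilt <-];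
        by move: z0 => /forallP/(_ (Ordinal ilt))/andP[].
    by rewrite normr0 addr_ge0 ?addr_ge0 // mulr_ge0 // mulr_ge0.
  rewrite negb_forall => /existsP[i]; rewrite -negb_or negbK => zi.
  have box1 : 1 <= box z.
    rewrite /box (big_nth (0, 0)) big_mkord (bigD1 i) //=.
    apply: le_trans (_ : 1 + 0 <= _); first by rewrite addr0.
    apply: lerD; last by apply: sumr_ge0 => j _; rewrite addr_ge0 // ler0n.
    by case/orP: zi => ->; rewrite ?lerDl ?lerDr ler0n.
  have -> : (DQ - DQ') z = - (DP - DQ) z + (DP' - DQ') z + (DP z - DP' z).
    by rewrite !fctE; ring.
  apply: le_trans (ler_normD _ _) _; apply: lerD.
    by apply: le_trans (ler_normD _ _) _; rewrite normrN.
  apply: le_trans (ler_normB _ _) _.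
  apply: le_trans (lerD (psum_crossing_le _ _ _ _ _)
    (psum_crossing_le _ _ _ _ _)) _.
  have : 0 <= (size P)%:R * (box z - 1) by rewrite mulr_ge0 ?subr_ge0.
  lra.
have -> : DP - DP' = (DP - DQ) + ((DQ - DQ') + (DQ' - DP')).
  by rewrite !subrKA.
apply: le_trans (cell_normD ax bY _ _) _.
apply: le_trans (lerD (lexx _) (cell_normD ax bY _ _)) _.
rewrite [X in _ + (_ + X)]cell_normB; move: E1 E2 E3; lra.
Qed.

End FixedPartitions.
End GreenComparison.

(** * Equality of the moments in the limit *)

Definition locally_lipschitz (R : realType) (F : R -> R) : Prop :=
  forall M, exists2 L, 0 <= L &
    forall u v, `|u| <= M -> `|v| <= M -> `|F u - F v| <= L * `|u - v|.

Section GreenLimit.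
Variable R : realType.
Implicit Types (s t u m M : R) (P Q : seq R) (F G : R -> R).
Variables (w : R -> R -> R) (r K : R).
Hypotheses (wP : control w) (r_gt : 2^-1 < r) (K_ge0 : 0 <= K).
Local Notation k := (cpow w r).
Local Notation k2 := (fun s t => k s t ^+ 2).
Local Notation holder_by := (holder_by w r K).

Lemma young_primitive_psum (f g I : R -> R) : young_primitive w r f g I ->
  exists2 C, 0 <= C & forall P, itv_partition 0 1 P ->
    `|I 1 - psum (fun s t => f s * (g t - g s)) 0 P| <= C * psum k2 0 P.
Proof.
move=> [I0 [C C0 IC]]; exists C => // P PP.
have -> : I 1 = psum (fun s u => I u - I s) 0 P.
  by rewrite psum_telescope I0 subr0; case: (PP) => _ /eqP ->.
rewrite /psum -sumrB mulr_sumr; apply: le_trans (ler_norm_sum _ _ _) _.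
apply: (@ler_psum _ (fun s t => `|I t - I s - f s * (g t - g s)|)
  (fun s t => C * k s t ^+ 2) _ _ _ PP) => s t s0 st t1.
by apply: IC => //; exact: ltW.
Qed.

Variables (x y x' y' : R -> R).
Hypotheses (xK : holder_by x) (yK : holder_by y).
Hypotheses (x'K : holder_by x') (y'K : holder_by y').
Hypotheses (y_closed : y 0 = y 1) (y'_closed : y' 0 = y' 1).
Hypothesis same_crossing : forall Q z, itv_partition 0 1 Q ->
  (forall c, c \in zip (0 :: Q) Q -> ~~ in_box w r K x y c z) ->
  (forall c, c \in zip (0 :: Q) Q -> ~~ in_box w r K x' y' c z) ->
  psum (crossing x y) 0 Q z = psum (crossing x' y') 0 Q z.

Lemma stieltjes_cells F G (u v : R -> R) a lx b ly P :
    path <%R a lx -> path <%R b ly -> itv_partition 0 1 P -> v 0 = v 1 ->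
    (forall s, s \in 0 :: P -> u s \in a :: lx /\ v s \in b :: ly) ->
  \sum_(e <- cells a lx b ly) psum (crossing u v) 0 P (cell_mid e) *
    ((F e.1.2 - F e.1.1) * (G e.2.2 - G e.2.1)) =
  psum (fun s t => F (u s) * (G (v t) - G (v s))) 0 P.
Proof.
move=> ax bY PP v01 uv.
under eq_bigr do rewrite psumE /psum mulr_suml.
rewrite exchange_big /=.
(* The increments of G along a closed curve sum to 0, so F may be shifted by a constant. *)
have -> : psum (fun s t => F (u s) * (G (v t) - G (v s))) 0 P =
    psum (fun s t => (F (u s) - F a) * (G (v t) - G (v s))) 0 P.
  have : psum (fun s t => G (v t) - G (v s)) 0 P = 0.
    by rewrite (psum_telescope (fun s => G (v s))); case: (PP) => _ /eqP ->;
      rewrite v01 subrr.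
  move=> /(congr1 ( *%R (F a))); rewrite mulr0 /psum mulr_sumr => E.
  by rewrite -[LHS]subr0 -[X in _ - X]E /psum -sumrB; apply: eq_bigr => c _;
    ring.
apply: eq_big_seq => c /(zip_partition_mem)[/uv[? ?] /uv[? ?]].
exact: cell_stieltjes.
Qed.

Lemma same_moments F G I I' : locally_lipschitz F -> locally_lipschitz G ->
  young_primitive w r (F \o x) (G \o y) I ->
  young_primitive w r (F \o x') (G \o y') I' -> I 1 = I' 1.
Proof.
move=> Flip Glip /young_primitive_psum[C C0 IC]
  /young_primitive_psum[C' C'0 I'C].
have hb f : holder_by f -> exists2 M, 0 <= M & forall t, 0 <= t -> t <= 1 ->
  `|f t| <= M.
  by move=> fK; apply: (holder_bounded wP r_gt); exists K.
have [Mx Mx0 xM] := hb _ xK; have [My My0 yM] := hb _ yK.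
have [Mx' Mx'0 x'M] := hb _ x'K; have [My' My'0 y'M] := hb _ y'K.
pose M := Mx + My + Mx' + My' + K * k 0 1.
have Kk0 : 0 <= K * k 0 1 by rewrite mulr_ge0 // cpow_ge0.
have [LF LF0 LFP] := Flip M; have [LG LG0 LGP] := Glip M.
(* B collects the coefficients of the error of P: two Young errors and the coarse part of
   [cell_norm_compare]. *)
pose B := C + C' + LF * LG * (4 * (sewC r * (K * K))).
have B0 : 0 <= B.
  apply: addr_ge0 (addr_ge0 C0 C'0) (mulr_ge0 (mulr_ge0 LF0 LG0) _).
  by apply: mulr_ge0 => //; exact:
    mulr_ge0 (sewC_ge0 r_gt) (mulr_ge0 K_ge0 K_ge0).
have B1 : 0 < B + 1 by rewrite ltr_wpDl.
apply/eqP; rewrite -subr_eq0 -normr_le0; apply/ler_addgt0Pl => e e0;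
  rewrite addr0.
have e2 : 0 < e / 2 by rewrite divr_gt0.
have [P PP Pe] := psum_cpow2_small wP r_gt (lexx 0) ler01 (lexx 1)
  (divr_gt0 e2 B1).
(* D contains the size of P, so Q0 can only be chosen once P is fixed. *)
pose D := LF * LG * (16 * (K * K) * (size P)%:R).
have D0 : 0 <= D by rewrite !mulr_ge0.
have D1 : 0 < D + 1 by rewrite ltr_wpDl.
have [Q0 Q0P Q0e] := psum_cpow2_small wP r_gt (lexx 0) ler01 (lexx 1)
  (divr_gt0 e2 D1).
have [Q [QQ PQ Q0Q]] := common_refinement PP Q0P.
have Qe := le_trans (psum_cpow2_refines wP r_gt (lexx 0) (lexx 1) Q0P Q0Q) Q0e.
have [a [lx [ax gx]]] : exists a lx, path <%R a lx /\
    a :: lx =i box_points w r K x Q ++ box_points w r K x' Q.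
  by apply: grid_of; rewrite /box_points.
have [b [ly [bY gy]]] : exists b ly, path <%R b ly /\
    b :: ly =i box_points w r K y Q ++ box_points w r K y' Q.
  by apply: grid_of; rewrite /box_points.
have main := cell_norm_compare wP r_gt K_ge0 xK yK x'K y'K PP PQ ax bY gx gy
  (fun z => @same_crossing Q z QQ).
have gridP s : s \in 0 :: P -> [/\ x s \in a :: lx, y s \in b :: ly,
    x' s \in a :: lx & y' s \in b :: ly].
  move=> /(refines_mem PQ) sQ; have H f := proj1 (box_pointsP w r K f Q) s sQ.
  by rewrite !gx !gy ![_ \in _ ++ box_points _ _ _ _ _]mem_cat !H !orbT.
have gridP1 s : s \in 0 :: P -> x s \in a :: lx /\ y s \in b :: ly.
  by move=> /gridP[].
have gridP2 s : s \in 0 :: P -> x' s \in a :: lx /\ y' s \in b :: ly.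
  by move=> /gridP[].
have S1 := stieltjes_cells F G ax bY PP y_closed gridP1.
have S2 := stieltjes_cells F G ax bY PP y'_closed gridP2.
have gM v : v \in a :: lx -> `|v| <= M.
  rewrite gx mem_cat => /orP[] /(box_points_le wP r_gt K_ge0 QQ).
    by move=> /(_ _ xM) H; apply: le_trans H _; rewrite lerD2r; lra.
  by move=> /(_ _ x'M) H; apply: le_trans H _; rewrite lerD2r; lra.
have gM' v : v \in b :: ly -> `|v| <= M.
  rewrite gy mem_cat => /orP[] /(box_points_le wP r_gt K_ge0 QQ).
    by move=> /(_ _ yM) H; apply: le_trans H _; rewrite lerD2r; lra.
  by move=> /(_ _ y'M) H; apply: le_trans H _; rewrite lerD2r; lra.
have := IC _ PP; have := I'C _ PP.
set s1 : R := psum (fun s t => F (x s) * (G (y t) - G (y s))) 0 P in S1 *.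
set s2 : R := psum (fun s t => F (x' s) * (G (y' t) - G (y' s))) 0 P in S2 *.
rewrite -[X in `|I' 1 - X|]/s2 -[X in `|I 1 - X|]/s1.
have E : `|s1 - s2| <= LF * LG *
    cell_norm a lx b ly (psum (crossing x y) 0 P - psum (crossing x' y') 0 P).
  rewrite -S1 -S2 -sumrB mulr_sumr; apply: le_trans (ler_norm_sum _ _ _) _.
  rewrite big_seq [leRHS]big_seq; apply: ler_sum => c /(cell_grid ax bY).
  move=> [c1 c2 [m1 m2 m3 m4] _].
  rewrite -mulrBl normrM mulrCA !fctE; apply: ler_wpM2l => //.
  rewrite normrM /cell_area -[c.1.2 - c.1.1]gtr0_norm ?subr_gt0 //.
  rewrite -[c.2.2 - c.2.1]gtr0_norm ?subr_gt0 // mulrACA.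
  by apply: ler_pM => //; [apply: LFP; exact: gM|apply: LGP; exact: gM'].
have {}E := le_trans E (ler_wpM2l (mulr_ge0 LF0 LG0) main).
set p := psum k2 0 P in Pe E *; set q := psum k2 0 Q in Qe E *.
move=> H1 H2.
have Bp : B * p <= e / 2.
  apply: le_trans (ler_wpM2l B0 Pe) _.
  by rewrite mulrCA ler_piMr ?(ltW e2) // ler_pdivrMr // mul1r lerDl.
have Dq : D * q <= e / 2.
  apply: le_trans (ler_wpM2l D0 Qe) _.
  by rewrite mulrCA ler_piMr ?(ltW e2) // ler_pdivrMr // mul1r lerDl.
have EE : C * p + C' * p + LF * LG * (4 * (sewC r * (K * K)) * p +
    16 * (K * K) * (size P)%:R * q) = B * p + D * q by rewrite /B /D; ring.
move: E H1 H2; rewrite !ler_norml => /andP[? ?] /andP[? ?] /andP[? ?].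
by apply/andP; split; lra.
Qed.

End GreenLimit.

(** * Continuous branches of the angle on half-planes *)

Section AngleBranches.
Variable R : realType.
Implicit Types (c s t u theta : R).

Lemma asin_ge0 s : 0 <= s <= 1 -> 0 <= asin s.
Proof.
move=> /andP[s0 s1]; rewrite leNgt; apply/negP => a0.
have s11 : -1 <= s <= 1 by rewrite s1 andbT (le_trans _ s0) // lerN10.
have pi0 := pi_gt0 R.
have : 0 < sin (- asin s).
  by apply: sin_gt0_pi; have := asin_geNpi2 s11; lra.
by rewrite sinN asinK ?in_itv /= // oppr_gt0 ltNge s0.
Qed.

Lemma asin_le0 s : -1 <= s <= 0 -> asin s <= 0.
Proof.
move=> /andP[s0 s1]; rewrite leNgt; apply/negP => a0.
have s11 : -1 <= s <= 1 by rewrite s0 (le_trans s1).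
have pi0 := pi_gt0 R.
have : 0 < sin (asin s).
  by apply: sin_gt0_pi; have := asin_lepi2 s11; lra.
by rewrite asinK ?in_itv /= // ltNge s1.
Qed.

(** The argument in (0, 2 pi] of the unit vector (c, s). *)
Definition cut_angle c s : R := if 0 < s then acos c else 2 * pi - acos c.

(* The last clause says that psi - cut_angle jumps only across the positive
   half-axis, where cut_angle is discontinuous. *)
Definition angle_branch (H : R -> R -> bool) (psi : R -> R -> R) : Prop :=
  [/\ forall c s, c ^+ 2 + s ^+ 2 = 1 -> H c s ->
        cos (psi c s) = c /\ sin (psi c s) = s,
      forall (C S : R -> R) u, {for u, continuous C} -> {for u, continuous S} ->
        C u ^+ 2 + S u ^+ 2 = 1 -> H (C u) (S u) ->
        {for u, continuous (fun u => psi (C u) (S u))} &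
      forall c s c' s', c ^+ 2 + s ^+ 2 = 1 -> c' ^+ 2 + s' ^+ 2 = 1 ->
        H c s -> H c' s' ->
        psi c' s' - psi c s = cut_angle c' s' - cut_angle c s +
          2 * pi * (((0 < s')%R%:R - (0 < s)%R%:R) * (0 < c)%R%:R)].

Lemma unit_itv c s : c ^+ 2 + s ^+ 2 = 1 -> -1 <= c <= 1.
Proof. by move=> cs; apply/andP; split; nra. Qed.

Lemma angle_branch_up : angle_branch (fun _ s => 0 < s) (fun c _ => acos c).
Proof.
split.
- move=> c s cs s0; have c1 := unit_itv cs.
  rewrite acosK ?in_itv //= sin_acos // -[1]cs addrAC subrr add0r sqrtr_sqr.
  by rewrite gtr0_norm.
- move=> C S u Cc Sc CS s0.
  apply: (@continuous_comp _ _ _ C (@acos R)) => //.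
  by apply: continuous_acos; nra.
- move=> c s c' s' _ _ s0 s'0; rewrite /cut_angle s0 s'0 subrr mul0r mulr0.
  by rewrite addr0.
Qed.

Lemma angle_branch_down :
  angle_branch (fun _ s => s < 0) (fun c _ => 2 * pi - acos c).
Proof.
split.
- move=> c s cs s0; have c1 := unit_itv cs.
  have -> : 2 * pi - acos c = - acos c + pi *+ 2 by rewrite mulr_natl addrC.
  rewrite cosD2pi sinD2pi cosN sinN.
  rewrite acosK ?in_itv //= sin_acos // -[1]cs addrAC subrr add0r sqrtr_sqr.
  by rewrite ltr0_norm // opprK.
- move=> C S u Cc Sc CS s0.
  apply: continuousB; first exact: cst_continuous.
  apply: (@continuous_comp _ _ _ C (@acos R)) => //.
  by apply: continuous_acos; nra.
- move=> c s c' s' _ _ s0 s'0;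
  rewrite /cut_angle !ltNge !(ltW s0) !(ltW s'0) /=.
  by rewrite subrr mul0r mulr0 addr0.
Qed.

Lemma cos_asin_unit c s : c ^+ 2 + s ^+ 2 = 1 -> cos (asin s) = `|c|.
Proof.
move=> cs; have s1 : -1 <= s <= 1 by apply: (@unit_itv s c); rewrite addrC.
by rewrite cos_asin // -[1]cs addrK sqrtr_sqr.
Qed.

Lemma angle_branch_left :
  angle_branch (fun c _ => c < 0) (fun _ s => pi - asin s).
Proof.
have cutE c s : c ^+ 2 + s ^+ 2 = 1 -> c < 0 -> cut_angle c s = pi - asin s.
  move=> cs c0; have s1 : -1 <= s <= 1 by apply: (@unit_itv s c); rewrite addrC.
  have a1 := asin_geNpi2 s1; have a2 := asin_lepi2 s1; have pi0 := pi_gt0 R.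
  have cE : c = - cos (asin s) by rewrite (cos_asin_unit cs) ltr0_norm ?opprK.
  have [s11 s12] := andP s1.
  rewrite /cut_angle; case: ifPn => [s0|].
    have a0 : 0 <= asin s by rewrite asin_ge0 // ltW.
    rewrite cE -cosN -cosDpi addrC cosK // in_itv /=; lra.
  rewrite -leNgt => s0; have a0 : asin s <= 0 by rewrite asin_le0 // s11.
  by rewrite cE -cosDpi cosK ?in_itv /=; lra.
split.
- move=> c s cs c0; have s1 : -1 <= s <= 1 by apply: (@unit_itv s c);
  rewrite addrC.
  rewrite [pi - _]addrC cosDpi sinDpi cosN sinN (cos_asin_unit cs).
  by rewrite asinK ?in_itv //= opprK ltr0_norm // opprK.
- move=> C S u Cc Sc CS s0.
  apply: continuousB; first exact: cst_continuous.
  apply: (@continuous_comp _ _ _ S (@asin R)) => //.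
  by apply: continuous_asin; nra.
- move=> c s c' s' cs cs' c0 c'0; rewrite !cutE //.
  by rewrite [0 < c]ltNge (ltW c0) !mulr0 addr0.
Qed.

(** The one half-plane of the four that meets the cut: there [cut_angle] is asin above the axis and
    asin + 2 pi on and below it. *)
Lemma angle_branch_right :
  angle_branch (fun c _ => 0 < c) (fun _ s => asin s).
Proof.
have cutE c s : c ^+ 2 + s ^+ 2 = 1 -> 0 < c ->
    cut_angle c s = asin s + 2 * pi * (1 - (0 < s)%R%:R).
  move=> cs c0; have s1 : -1 <= s <= 1 by apply: (@unit_itv s c); rewrite addrC.
  have a1 := asin_geNpi2 s1; have a2 := asin_lepi2 s1; have pi0 := pi_gt0 R.
  have cE : c = cos (asin s) by rewrite (cos_asin_unit cs) gtr0_norm.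
  have [s11 s12] := andP s1.
  rewrite /cut_angle; case: ifPn => [s0|].
    have a0 : 0 <= asin s by rewrite asin_ge0 // ltW.
    by rewrite subrr mulr0 addr0 {1}cE cosK // in_itv /=; lra.
  rewrite -leNgt => s0; have a0 : asin s <= 0 by rewrite asin_le0 // s11.
  rewrite {1}cE -cosN cosK ?in_itv /=; lra.
split.
- move=> c s cs c0; have s1 : -1 <= s <= 1 by apply: (@unit_itv s c);
  rewrite addrC.
  by rewrite (cos_asin_unit cs) asinK ?in_itv //= gtr0_norm.
- move=> C S u Cc Sc CS s0.
  apply: (@continuous_comp _ _ _ S (@asin R)) => //.
  by apply: continuous_asin; nra.
- move=> c s c' s' cs cs' c0 c'0; rewrite !cutE // c0 mulr1; ring.
Qed.

Lemma same_angle_increment (h h' : R -> R) :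
    {within `[0, 1], continuous h} -> {within `[0, 1], continuous h'} ->
    (forall u, 0 <= u -> u <= 1 ->
      cos (h u) = cos (h' u) /\ sin (h u) = sin (h' u)) ->
  h 1 - h 0 = h' 1 - h' 0.
Proof.
move=> hc h'c hh; pose D u := h u - h' u.
have Dc : {within `[0, 1], continuous D} by exact: within_continuousB.
have D1 u : 0 <= u -> u <= 1 -> cos (D u) = 1 /\ sin (D u) = 0.
  move=> u0 u1; have [hcos hsin] := hh u u0 u1.
  by rewrite /D cosB sinB hcos hsin -!expr2 cos2Dsin2; split=> //; ring.
suff : D 0 = D 1 by rewrite /D; lra.
apply/eqP/negPn/negP => D01.
(* If D were not constant at the ends, it would take a value at distance d from [D 0]; as 0 < d <= 1
   < pi, its sine would not vanish there. *)
pose d : R := Num.min 1 `|D 1 - D 0|.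
have d0 : 0 < d by rewrite lt_min ltr01 normr_gt0 subr_eq0 eq_sym.
have d1 : d <= 1 by rewrite ge_min lexx.
have dD : d <= `|D 1 - D 0| by rewrite ge_min lexx orbT.
have sd : 0 < sin d by apply: sin2_gt0; lra.
have [cos0 sin0] := D1 0 (lexx 0) ler01.
have notin v : Num.min (D 0) (D 1) <= v <= Num.max (D 0) (D 1) -> sin v = 0.
  move=> /(IVT ler01 Dc)[u + <-]; rewrite in_itv /= => /andP[u0 u1].
  by have [] := D1 u u0 u1.
case: (ltgtP (D 0) (D 1)) D01 => // D01 _.
  have := notin (D 0 + d); rewrite min_l ?max_r ?(ltW D01) //.
  rewrite sinD cos0 sin0 mul0r add0r mul1r; move: dD sd.
  rewrite gtr0_norm ?subr_gt0 // => dD sd H; have := sd; rewrite H ?ltxx //.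
  by apply/andP; split; lra.
have := notin (D 0 - d); rewrite min_r ?max_l ?(ltW D01) //.
rewrite sinB cos0 sin0 mul0r sub0r mul1r; move: dD sd.
rewrite ltr0_norm ?subr_lt0 // => dD sd H; have := sd.
rewrite -oppr_lt0 H ?ltxx //; apply/andP; split; lra.
Qed.
End AngleBranches.

(** * Angle lifts and winding numbers *)

Section Winding.
Variable R : realType.
Implicit Types (c s t u theta : R).

(** Freezes a curve outside an interval, so that lifts can be glued as functions continuous on the
    whole line. *)
Definition clamp a b u : R := Num.min (Num.max u a) b.

Lemma clamp_itv a b u : a <= b -> a <= clamp a b u <= b.
Proof. by move=> ab; rewrite /clamp le_min ab le_max lexx orbT ge_min lexx orbT.
  Qed.

Lemma clamp_id a b u : a <= u -> u <= b -> clamp a b u = u.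
Proof. by move=> au ub; rewrite /clamp max_l // min_l. Qed.

Lemma clamp_dist a b u t : a <= b -> `|clamp a b u - clamp a b t| <= `|u - t|.
Proof.
move=> ab; have := ler_norm (u - t); have := ler_norm (t - u).
rewrite [`|t - u|]distrC => h1 h2; rewrite ler_norml /clamp /Num.min /Num.max.
case: (ltP u a) => ua; case: (ltP t a) => ta; case: ltP => ?; case: ltP => ?;
  by apply/andP; split; lra.
Qed.

Lemma clamp_continuous a b : a <= b -> continuous (clamp a b).
Proof.
move=> ab u; apply: (@continuous_min R R (fun u => Num.max u a) (fun=> b)).
  by apply: continuous_max; [exact: cvg_id|exact: cst_continuous].
exact: cst_continuous.
Qed.

(** One branch per piece is glued to the next. The changes of [cut_angle] telescope, and what
    remains is 2 pi times the signed count of jumps across the positive half-axis. *)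
Lemma angle_lift_ex (C S : R -> R) a P theta :
    continuous C -> continuous S -> (forall u, C u ^+ 2 + S u ^+ 2 = 1) ->
    path <%R a P ->
    (forall p, p \in zip (a :: P) P -> exists H psi, angle_branch H psi /\
      forall u, p.1 <= u -> u <= p.2 -> H (C u) (S u)) ->
    cos theta = C a -> sin theta = S a ->
  exists h, [/\ continuous h, h a = theta,
    forall u, a <= u -> u <= last a P -> cos (h u) = C u /\ sin (h u) = S u &
    h (last a P) - theta =
      cut_angle (C (last a P)) (S (last a P)) - cut_angle (C a) (S a) +
      2 * pi * psum (fun s t => ((0 < S t)%R%:R - (0 < S s)%R%:R) *
        (0 < C s)%R%:R) a P].
Proof.
move=> Cc Sc CS; elim: P a theta => [|x P IHP] a theta aP HP cE sE.
  exists (fun=> theta); split=> //.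
  - by move=> u; exact: cst_continuous.
  - by move=> u au ua; have -> : u = a by apply/eqP; rewrite eq_le ua.
  - by rewrite psum_nil !subrr mulr0 addr0.
move: aP => /= /andP[ax xP]; have axle := ltW ax.
have [|H [psi [[psiE psiC psiD] HH]]] := HP (a, x); first by rewrite inE eqxx.
have {}HH u : a <= u -> u <= x -> H (C u) (S u) by exact: HH.
pose h1 u := psi (C (clamp a x u)) (S (clamp a x u)).
have h1E u : a <= u -> u <= x -> h1 u = psi (C u) (S u).
  by move=> au ux; rewrite /h1 clamp_id.
have h1c : continuous h1.
  move=> u; have /andP[k1 k2] := @clamp_itv a x u axle.
  apply: (psiC (C \o clamp a x) (S \o clamp a x)); rewrite /= ?CS ?HH //.
    by apply: continuous_comp; [exact: clamp_continuous|exact: Cc].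
  by apply: continuous_comp; [exact: clamp_continuous|exact: Sc].
(* Only increments of the branch are used, since theta may differ from its initial value by a
   multiple of 2 pi. *)
pose theta1 := theta + (h1 x - h1 a).
have angle u : a <= u -> u <= x ->
    cos (theta + (h1 u - h1 a)) = C u /\ sin (theta + (h1 u - h1 a)) = S u.
  move=> au ux; rewrite !h1E //.
  have [c1 s1] := psiE _ _ (CS u) (HH _ au ux).
  have [c2 s2] := psiE _ _ (CS a) (HH _ (lexx _) axle).
  have -> : theta + (psi (C u) (S u) - psi (C a) (S a)) =
    (theta - psi (C a) (S a)) + psi (C u) (S u) by ring.
  have [cA sA] : cos (theta - psi (C a) (S a)) = 1 /\
      sin (theta - psi (C a) (S a)) = 0.
    by rewrite cosB sinB c2 s2 cE sE -!expr2 CS; split=> //; ring.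
  by rewrite cosD cA sA sinD cA sA c1 s1 !mul0r !mul1r subr0 add0r.
have [cx sx] := angle x axle (lexx x).
have [|h2 [h2c h2x h2E h2D]] := IHP x theta1 xP _ cx sx.
  by move=> p pP; apply: HP; rewrite inE pP orbT.
have lx : x <= last x P by apply: (@itv_partition_le _ _ _ _ P); split.
(* Up to x the last bracket is 0; beyond x the function [h1] is constant, thanks to [clamp]. *)
pose h u := theta + (h1 u - h1 a) + (h2 (Num.max u x) - theta1).
have hl u : u <= x -> h u = theta + (h1 u - h1 a).
  by move=> ux; rewrite /h max_r // h2x subrr addr0.
have hr u : x <= u -> h u = h2 u.
  move=> xu; rewrite /h max_l // /theta1.
  have -> : h1 u = h1 x by rewrite /h1 /clamp !max_l ?min_r ?min_l
    ?(le_trans axle) //.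
  by ring.
exists h; split.
- move=> u; apply: cvgD.
    by apply: cvgD; [exact: cvg_cst|apply: cvgB; [exact: h1c|exact: cvg_cst]].
  apply: cvgB; last exact: cvg_cst.
  apply: (@continuous_comp _ _ _ (fun u => Num.max u x) h2); last exact: h2c.
  by apply: continuous_max; [exact: cvg_id|exact: cst_continuous].
- by rewrite hl // subrr addr0.
- move=> u au ul; case: (leP u x) => [ux|/ltW xu]; first by rewrite hl //;
  exact: angle.
  by rewrite hr //; exact: h2E.
- rewrite /= hr // psum_cons.
  have := psiD _ _ _ _ (CS a) (CS x) (HH _ (lexx _) axle) (HH _ axle (lexx _)).
  rewrite -!h1E //; move: h2D; rewrite /theta1 => h2D pD.
  have -> : h2 (last x P) - theta =
    (h2 (last x P) - (theta + (h1 x - h1 a))) + (h1 x - h1 a) by ring.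
  by rewrite h2D pD; ring.
Qed.

End Winding.

Lemma partition_cover (R : realType) (a b u : R) P : itv_partition a b P ->
    a < b -> a <= u -> u <= b ->
  exists2 p, p \in zip (a :: P) P & p.1 <= u <= p.2.
Proof.
elim: P a => [|x P IHP] a PP ab au ub.
  by move: ab; rewrite (itv_partition_nil PP) ltxx.
have PP' := itv_partition_cons PP.
case: (leP u x) => [ux|xu].
  by exists (a, x); rewrite ?inE ?eqxx //= au.
have [p pP up] := IHP _ PP' (lt_le_trans xu ub) (ltW xu) ub.
by exists p => //=; rewrite inE pP orbT.
Qed.

Definition pair_row (R : realType) (z : R * R) : 'rV[R]_2 :=
  \row_j (if j == 0 then z.1 else z.2).

Section WindingCrossing.
Variables (R : realType) (g : R -> 'rV[R]_2) (z : R * R) (Q : seq R).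
Hypothesis g_cont : {within `[0, 1], continuous g}.
Hypothesis g_closed : g 0 = g 1.
Hypothesis QQ : itv_partition 0 1 Q.
Hypothesis half_planes : forall p, p \in zip (0 :: Q) Q ->
  [\/ forall u, p.1 <= u -> u <= p.2 -> z.1 < g u 0 0,
      forall u, p.1 <= u -> u <= p.2 -> g u 0 0 < z.1,
      forall u, p.1 <= u -> u <= p.2 -> z.2 < g u 0 1 |
      forall u, p.1 <= u -> u <= p.2 -> g u 0 1 < z.2].

Let Z := pair_row z.

Let ZE0 u : (u - Z) 0 0 = u 0 0 - z.1.
Proof. by rewrite !mxE. Qed.

Let ZE1 u : (u - Z) 0 1 = u 0 1 - z.2.
Proof. by rewrite !mxE. Qed.

Let off_point u : 0 <= u -> u <= 1 -> 0 < enorm (g u - Z).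
Proof.
move=> u0 u1; rewrite /enorm sqrtr_gt0 ZE0 ZE1.
have [p pQ /andP[pu up]] := partition_cover QQ ltr01 u0 u1.
case: (half_planes pQ) => /(_ u pu up) H.
- by rewrite ltr_wpDr ?sqr_ge0 // exprn_even_gt0 //= subr_eq0 gt_eqF.
- by rewrite ltr_wpDr ?sqr_ge0 // exprn_even_gt0 //= subr_eq0 lt_eqF.
- by rewrite ltr_wpDl ?sqr_ge0 // exprn_even_gt0 //= subr_eq0 gt_eqF.
- by rewrite ltr_wpDl ?sqr_ge0 // exprn_even_gt0 //= subr_eq0 lt_eqF.
Qed.

Lemma half_planes_off_image : ~ (g @` `[0, 1]) Z.
Proof.
move=> [u /=]; rewrite in_itv /= => /andP[u0 u1] guZ.
by have := off_point u0 u1;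
  rewrite guZ subrr /enorm !mxE expr0n addr0 sqrtr0 ltxx.
Qed.

Lemma clamp_coord_continuous i : continuous (fun u => g (clamp 0 1 u) 0 i).
Proof.
move=> u; apply/cvgrPdist_le => e e0.
have [d d0 gd] := segment_uniform_continuous g_cont e0.
near=> t.
have -> : g (clamp 0 1 u) 0 i - g (clamp 0 1 t) 0 i =
  (g (clamp 0 1 u) - g (clamp 0 1 t)) 0 i by rewrite !mxE.
have /andP[u0 u1] := clamp_itv u (@ler01 R).
have /andP[t0 t1] := clamp_itv t (@ler01 R).
apply: le_trans (_ : `|g (clamp 0 1 u) - g (clamp 0 1 t)| <= _).
  rewrite [leRHS]/Num.norm /= mx_normrE.
  exact: (le_bigmax _ (fun ij => `|(_ : 'rV[R]_2) ij.1 ij.2|) (0, i)).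
apply: gd => //; apply: le_lt_trans (clamp_dist _ _ (@ler01 R)) _.
by near: t; exists d.
Unshelve. all: by end_near. Qed.

(** The jumps counted by [angle_lift_ex] for the normalized curve are the crossings of the ray.
    Closedness cancels the terms in [cut_angle], and [same_angle_increment] makes the result
    independent of the lift. *)
Lemma winding_crossing :
  winding_number g Z = psum (crossing (fun u => g u 0 0) (fun u => g u 0 1)) 0 Q
    z.
Proof.
pose X u := g (clamp 0 1 u) 0 0 - z.1; pose Y u := g (clamp 0 1 u) 0 1 - z.2.
pose n u := Num.sqrt (X u ^+ 2 + Y u ^+ 2).
have nE u : n u = enorm (g (clamp 0 1 u) - Z) by rewrite /enorm ZE0 ZE1.
have n0 u : 0 < n u.
  have /andP[u0 u1] := clamp_itv u (@ler01 R).
  by rewrite nE off_point.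
have Xc : continuous X.
  by move=> u; apply: cvgB; [exact: clamp_coord_continuous|exact: cvg_cst].
have Yc : continuous Y.
  by move=> u; apply: cvgB; [exact: clamp_coord_continuous|exact: cvg_cst].
have nc : continuous n.
  move=> u; apply: (@continuous_comp _ _ _ (fun u => X u ^+ 2 + Y u ^+ 2)
    Num.sqrt).
    by apply: cvgD; rewrite expr2; apply: cvgM;
      [exact: Xc|exact: Xc|exact: Yc|exact: Yc].
  exact: sqrt_continuous.
pose C u := X u / n u; pose S u := Y u / n u.
have Cc : continuous C.
  by move=> u; apply: cvgM; [exact: Xc|apply: cvgV; [rewrite gt_eqF|exact: nc]].
have Sc : continuous S.
  by move=> u; apply: cvgM; [exact: Yc|apply: cvgV; [rewrite gt_eqF|exact: nc]].
have CS u : C u ^+ 2 + S u ^+ 2 = 1.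
  rewrite /C /S !expr_div_n -mulrDl sqr_sqrtr ?addr_ge0 ?sqr_ge0 //.
  rewrite divff // gt_eqF //; have := n0 u; rewrite /n sqrtr_gt0 //.
have inE01 u : 0 <= u -> u <= 1 -> C u = (g u - Z) 0 0 / enorm (g u - Z) /\
    S u = (g u - Z) 0 1 / enorm (g u - Z).
  by move=> u0 u1; rewrite /C /S nE /X /Y clamp_id // ZE0 ZE1.
have signs u : 0 <= u -> u <= 1 ->
    [/\ (0 < C u) = (z.1 < g u 0 0), (0 < S u) = (z.2 < g u 0 1),
        (C u < 0) = (g u 0 0 < z.1) & (S u < 0) = (g u 0 1 < z.2)].
  move=> u0 u1; have nu := n0 u; rewrite /C /S.
  rewrite !pmulr_lgt0 ?pmulr_llt0 ?invr_gt0 //.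
  by rewrite /X /Y clamp_id // !subr_gt0 !subr_lt0.
have [theta [cE sE]] : exists theta, cos theta = C 0 /\ sin theta = S 0.
  have c1 := unit_itv (CS 0); case: (ltP 0 (S 0)) => [S0|].
    by exists (acos (C 0)); have [H _ _] := angle_branch_up R; exact: H.
  rewrite le_eqVlt => /orP[/eqP S0|S0]; last first.
    by exists (2 * pi - acos (C 0)); have [H _ _] := angle_branch_down R;
      exact: (H _ _ (CS 0)).
  (* On the horizontal axis neither the upper nor the lower branch applies, but acos has sine 0
     there. *)
  exists (acos (C 0)); rewrite acosK ?in_itv //= sin_acos // -[1](CS 0).
  by rewrite S0 expr0n addr0 subrr sqrtr0.
have [path01 /eqP last1] := QQ.
have branches p : p \in zip (0 :: Q) Q -> exists H psi, angle_branch H psi /\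
    forall u, p.1 <= u -> u <= p.2 -> H (C u) (S u).
  move=> pQ; have [p0 pp p1] := itv_partition_zip QQ pQ.
  have itv u : p.1 <= u -> u <= p.2 -> 0 <= u /\ u <= 1.
    by move=> pu up; split; [exact: le_trans pu|exact: le_trans p1].
  case: (half_planes pQ) => Hp.
  - exists (fun c _ => 0 < c), (fun _ s => asin s); split;
    first exact: angle_branch_right.
    by move=> u pu up; have [u0 u1] := itv u pu up;
      have [-> _ _ _] := signs u u0 u1; exact: Hp.
  - exists (fun c _ => c < 0), (fun _ s => pi - asin s); split;
    first exact: angle_branch_left.
    by move=> u pu up; have [u0 u1] := itv u pu up;
      have [_ _ -> _] := signs u u0 u1; exact: Hp.
  - exists (fun _ s => 0 < s), (fun c _ => acos c); split;
    first exact: angle_branch_up.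
    by move=> u pu up; have [u0 u1] := itv u pu up;
      have [_ -> _ _] := signs u u0 u1; exact: Hp.
  - exists (fun _ s => s < 0), (fun c _ => 2 * pi - acos c); split;
    first exact: angle_branch_down.
    by move=> u pu up; have [u0 u1] := itv u pu up;
      have [_ _ _ ->] := signs u u0 u1; exact: Hp.
have [h [hc h0 hE hD]] := angle_lift_ex Cc Sc CS path01 branches cE sE.
rewrite last1 in hE hD.
have liftP : is_angle_lift g Z h.
  split; first exact: continuous_subspaceT.
  move=> u; rewrite in_itv /= => /andP[u0 u1].
  by have [<- <-] := inE01 u u0 u1; exact: hE.
have C01 : C 1 = C 0 /\ S 1 = S 0.
  by rewrite /C /S /n /X /Y !clamp_id // g_closed.
have pi0 := pi_gt0 R.
have hW : (h 1 - h 0) / (2 * pi) =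
    psum (crossing (fun u => g u 0 0) (fun u => g u 0 1)) 0 Q z.
  rewrite h0 hD (proj1 C01) (proj2 C01) subrr add0r mulrC mulKf ?mulf_neq0
    ?gt_eqF //.
  rewrite psumE /psum; apply: eq_big_seq => p pQ.
  have [p0 pp p1] := itv_partition_zip QQ pQ.
  have [-> -> _ _] := signs p.1 p0 (le_trans (ltW pp) p1).
  by have [_ -> _ _] := signs p.2 (le_trans p0 (ltW pp)) p1.
rewrite -hW /winding_number; apply: xget_subset1; first by exists h.
move=> a b [ha haP ->] [hb hbP ->]; congr (_ / _).
case: haP hbP => [hac haE] [hbc hbE].
apply: same_angle_increment => // u u0 u1.
have u01 : u \in `[0, 1] by rewrite in_itv /= u0.
by have [-> ->] := haE u u01; have [-> ->] := hbE u u01.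
Qed.
End WindingCrossing.

(** * The logarithm up to a given degree *)

Section Logarithm.
Variable R : realType.
Implicit Types (a b : tensor_series R) (n : nat) (v : seq 'I_2).

Lemma tmul_agree n a a' b b' :
    (forall v, (size v <= n)%N -> a v = a' v) ->
    (forall v, (size v <= n)%N -> b v = b' v) ->
  forall v, (size v <= n)%N -> tmul a b v = tmul a' b' v.
Proof.
move=> aa bb v vn; apply: eq_bigr => i _; rewrite aa ?bb //.
  by rewrite size_drop (leq_trans (leq_subr _ _)).
by rewrite size_take_min (leq_trans (geq_minr _ _)).
Qed.

Lemma tlog_agree n a a' : (forall v, (size v <= n)%N -> a v = a' v) ->
  forall v, (size v <= n)%N -> tlog a v = tlog a' v.
Proof.
move=> aa v vn; apply: eq_bigr => k _; congr (_ * _).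
elim: k v vn => [|k IHk] v vn //.
by apply: tmul_agree vn => // u un; rewrite /tsub aa.
Qed.

End Logarithm.

(** * Shuffle algebra up to degree 4 *)

Lemma shuffle_nseq (i : 'I_2) n :
  shuffle [:: i] (nseq n i) = nseq n.+1 (nseq n.+1 i).
Proof.
elim: n => // n IHn; rewrite [nseq n.+1 i]/= shuffle_cons IHn /=.
rewrite /letter_cons map_nseq -[X in _ ++ X]/(nseq 1 (nseq n.+2 i)).
by rewrite -nseqD addn1.
Qed.

Lemma ord2P (i : 'I_2) : i = 0 \/ i = 1.
Proof. by case: i => -[|[|//]] lti; [left|right]; exact: val_inj. Qed.

(* In degree at most 4 the shuffle relations, s [:: 0] = s [:: 1] = 0 and the
   values of the moments int x^a/a! d(y^b/b!) with a + b <= 4 form a system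
   of equations with a unique solution. *)
Section LowDegrees.
Variables (R : realType) (s s' : seq 'I_2 -> R).
Hypotheses (s_shuffle : forall u v, s u * s v = \sum_(x <- shuffle u v) s x).
Hypotheses (s'_shuffle : forall u v,
  s' u * s' v = \sum_(x <- shuffle u v) s' x).
Hypotheses (s1 : forall i, s [:: i] = 0) (s'1 : forall i, s' [:: i] = 0).
Hypotheses (s0 : s [::] = 1) (s'0 : s' [::] = 1).
Hypothesis moments : forall a b,
  \sum_(x <- shuffle (nseq a.+1 0) (nseq b 1)) s (1 :: x) =
  \sum_(x <- shuffle (nseq a.+1 0) (nseq b 1)) s' (1 :: x).

Let shuffle1 i v : \sum_(x <- shuffle [:: i] v) s x = 0.
Proof. by rewrite -s_shuffle s1 mul0r. Qed.

Let shuffle1' i v : \sum_(x <- shuffle [:: i] v) s' x = 0.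
Proof. by rewrite -s'_shuffle s'1 mul0r. Qed.

Let two i j : s [:: i; j] = s' [:: i; j].
Proof.
move: (shuffle1 0 [:: 0]) (shuffle1 0 [:: 1]) (shuffle1 1 [:: 1]).
move: (shuffle1' 0 [:: 0]) (shuffle1' 0 [:: 1]) (shuffle1' 1 [:: 1]).
move: (moments 0 0); rewrite /= ?big_cons ?big_nil => *.
by case: (ord2P i) => ->; case: (ord2P j) => ->; lra.
Qed.

Let three i j k : s [:: i; j; k] = s' [:: i; j; k].
Proof.
move: (shuffle1 0 [:: 0; 0]) (shuffle1 0 [:: 0; 1]) (shuffle1 0 [:: 1; 0])
  (shuffle1 0 [:: 1; 1]) (shuffle1 1 [:: 0; 0]) (shuffle1 1 [:: 0; 1])
  (shuffle1 1 [:: 1; 0]) (shuffle1 1 [:: 1; 1]).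
move: (shuffle1' 0 [:: 0; 0]) (shuffle1' 0 [:: 0; 1]) (shuffle1' 0 [:: 1; 0])
  (shuffle1' 0 [:: 1; 1]) (shuffle1' 1 [:: 0; 0]) (shuffle1' 1 [:: 0; 1])
  (shuffle1' 1 [:: 1; 0]) (shuffle1' 1 [:: 1; 1]).
move: (moments 1 0) (moments 0 1); rewrite /= ?big_cons ?big_nil => *.
by case: (ord2P i) => ->; case: (ord2P j) => ->; case: (ord2P k) => ->; lra.
Qed.

Let four i j k l : s [:: i; j; k; l] = s' [:: i; j; k; l].
Proof.
have w40 : s [:: 0; 0; 0; 0] = s' [:: 0; 0; 0; 0].
  move: (shuffle1 0 [:: 0; 0; 0]) (shuffle1' 0 [:: 0; 0; 0]).
  rewrite /= ?big_cons ?big_nil => *; repeat split; lra.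
have w31 : s [:: 0; 0; 0; 1] = s' [:: 0; 0; 0; 1] /\
      s [:: 0; 0; 1; 0] = s' [:: 0; 0; 1; 0] /\
      s [:: 0; 1; 0; 0] = s' [:: 0; 1; 0; 0] /\
      s [:: 1; 0; 0; 0] = s' [:: 1; 0; 0; 0].
  move: (moments 2 0)
    (shuffle1 0 [:: 0; 0; 1]) (shuffle1' 0 [:: 0; 0; 1])
    (shuffle1 0 [:: 0; 1; 0]) (shuffle1' 0 [:: 0; 1; 0])
    (shuffle1 0 [:: 1; 0; 0]) (shuffle1' 0 [:: 1; 0; 0]).
  rewrite /= ?big_cons ?big_nil => *; repeat split; lra.
have w22 : s [:: 0; 0; 1; 1] = s' [:: 0; 0; 1; 1] /\
      s [:: 0; 1; 0; 1] = s' [:: 0; 1; 0; 1] /\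
      s [:: 0; 1; 1; 0] = s' [:: 0; 1; 1; 0] /\
      s [:: 1; 0; 0; 1] = s' [:: 1; 0; 0; 1] /\
      s [:: 1; 0; 1; 0] = s' [:: 1; 0; 1; 0] /\
      s [:: 1; 1; 0; 0] = s' [:: 1; 1; 0; 0].
  (* With two letters of each kind, the shuffles with a single letter leave two degrees of freedom;
     the moment fixes one, and this square, known from degree 2, the other. *)
  have prod : s [:: 0; 1] * s [:: 0; 1] = s' [:: 0; 1] * s' [:: 0; 1].
    by rewrite two.
  rewrite s_shuffle s'_shuffle in prod.
  move: (moments 1 1) prod
    (shuffle1 0 [:: 0; 1; 1]) (shuffle1' 0 [:: 0; 1; 1])
    (shuffle1 0 [:: 1; 0; 1]) (shuffle1' 0 [:: 1; 0; 1])
    (shuffle1 0 [:: 1; 1; 0]) (shuffle1' 0 [:: 1; 1; 0])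
    (shuffle1 1 [:: 0; 0; 1]) (shuffle1' 1 [:: 0; 0; 1])
    (shuffle1 1 [:: 1; 0; 0]) (shuffle1' 1 [:: 1; 0; 0]).
  rewrite /= ?big_cons ?big_nil => *; repeat split; lra.
have w13 : s [:: 0; 1; 1; 1] = s' [:: 0; 1; 1; 1] /\
      s [:: 1; 0; 1; 1] = s' [:: 1; 0; 1; 1] /\
      s [:: 1; 1; 0; 1] = s' [:: 1; 1; 0; 1] /\
      s [:: 1; 1; 1; 0] = s' [:: 1; 1; 1; 0].
  move: (moments 0 2)
    (shuffle1 1 [:: 0; 1; 1]) (shuffle1' 1 [:: 0; 1; 1])
    (shuffle1 1 [:: 1; 0; 1]) (shuffle1' 1 [:: 1; 0; 1])
    (shuffle1 1 [:: 1; 1; 0]) (shuffle1' 1 [:: 1; 1; 0]).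
  rewrite /= ?big_cons ?big_nil => *; repeat split; lra.
have w04 : s [:: 1; 1; 1; 1] = s' [:: 1; 1; 1; 1].
  move: (shuffle1 1 [:: 1; 1; 1]) (shuffle1' 1 [:: 1; 1; 1]).
  rewrite /= ?big_cons ?big_nil => *; repeat split; lra.
case: w31 w22 w13 => ? [? [? ?]] [? [? [? [? [? ?]]]]] [? [? [? ?]]].
by case: (ord2P i) => ->; case: (ord2P j) => ->; case: (ord2P k) => ->;
  case: (ord2P l) => ->.
Qed.

Lemma low_degrees v : (size v <= 4)%N -> s v = s' v.
Proof.
case: v => [|i [|j [|k [|l [|m v]]]]] v4.
- by rewrite s0 s'0.
- by rewrite s1 s'1.
- exact: two.
- exact: three.
- exact: four.
- by move: v4.
Qed.

End LowDegrees.

(** * Moments as iterated integrals *)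

Section PowerMoments.
Variable R : realType.
Variables (w : R -> R -> R) (r : R).
Hypotheses (wP : control w) (r_gt : 2^-1 < r).
Variable g : R -> 'rV[R]_2.
Hypothesis gH : forall i, holder w r (fun u => g u 0 i).
Local Notation T := (iterated_integral g).

Lemma iterated_integral1 i t : 0 <= t -> t <= 1 ->
  T [:: i] t = g t 0 i - g 0 0 i.
Proof.
have [_ /(_ i) iI] := iterated_integral_primitive wP r_gt gH [::].
exact: (young_primitive_unique wP r_gt iI (young_primitive_cst w r _)).
Qed.

(** Shuffling one letter into its n-th power gives n + 1 copies of the next power, whence the
    factorial. *)
Lemma iterated_integral_nseq i n t : 0 <= t -> t <= 1 ->
  T (nseq n i) t = (g t 0 i - g 0 0 i) ^+ n / n`!%:R.
Proof.
move=> t0 t1; elim: n => [|n IHn]; first by rewrite /= expr0 divr1.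
have := shuffle_product wP r_gt gH [:: i] (nseq n i) t0 t1.
rewrite shuffle_nseq big_nseq iter_addr addr0 iterated_integral1 // IHn => E.
have -> : T (nseq n.+1 i) t = (T (nseq n.+1 i) t *+ n.+1) / n.+1%:R.
  by rewrite -(mulr_natr (T _ t)) mulfK // pnatr_eq0.
rewrite -E exprS factS natrM invfM; ring.
Qed.

(** Both functions are iterated integrals over constant words, so their Young integral is a shuffle
    followed by the last letter 1. *)
Lemma shuffle_moment a b : exists I,
  [/\ young_primitive w r (fun t => (g t 0 0 - g 0 0 0) ^+ a / a`!%:R)
        (fun t => (g t 0 1 - g 0 0 1) ^+ b.+1 / b.+1`!%:R) I &
      I 1 = \sum_(x <- shuffle (nseq a 0) (nseq b 1)) T (1 :: x) 1].
Proof.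
have [aH _] := iterated_integral_primitive wP r_gt gH (nseq a 0).
have [bH _] := iterated_integral_primitive wP r_gt gH (nseq b.+1 1).
have [I IP] := young_primitive_ex wP r_gt aH bH; exists I; split.
  by apply: (eq_young_primitive _ _ _ IP) => // t t0 t1;
    exact: iterated_integral_nseq.
apply: (shuffle_primitive wP r_gt gH _ IP) => // t t0 t1.
exact: (shuffle_product wP r_gt gH).
Qed.

End PowerMoments.

Lemma locally_lipschitz_pow (R : realType) n c :
  locally_lipschitz (fun v : R => v ^+ n * c).
Proof.
elim: n => [|n IHn] M.
  by exists 0 => // u v _ _; rewrite subrr normr0 mul0r.
have [L L0 LP] := IHn M; exists (`|M| * L + `|M| ^+ n * `|c|).
  by rewrite addr_ge0 ?mulr_ge0 ?exprn_ge0.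
move=> u v uM vM.
have -> : u ^+ n.+1 * c - v ^+ n.+1 * c =
  u * (u ^+ n * c - v ^+ n * c) + v ^+ n * c * (u - v) by rewrite !exprS; ring.
have uM' := le_trans uM (ler_norm M); have vM' := le_trans vM (ler_norm M).
apply: le_trans (ler_normD _ _) _; rewrite !normrM normrX mulrDl -!mulrA.
apply: lerD; first by apply: ler_pM => //; exact: LP.
by rewrite ler_wpM2r ?mulr_ge0 // lerXn2r ?nnegrE.
Qed.

(** * Half-planes from boxes, and the conclusion *)

Section BoxHalfPlanes.
Variables (R : realType) (w : R -> R -> R) (r K : R).
Hypotheses (wP : control w) (r_gt : 2^-1 < r) (K_ge0 : 0 <= K).

(** Each piece of the curve stays in its box, and a point off the box lies strictly beyond one of
    its four sides. *)
Lemma off_box_half_planes (h : R -> 'rV[R]_2) Q z :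
    (forall i, holder_by w r K (fun u => h u 0 i)) ->
    itv_partition 0 1 Q ->
    (forall c, c \in zip (0 :: Q) Q ->
      ~~ in_box w r K (fun u => h u 0 0) (fun u => h u 0 1) c z) ->
  forall p, p \in zip (0 :: Q) Q ->
  [\/ forall u, p.1 <= u -> u <= p.2 -> z.1 < h u 0 0,
      forall u, p.1 <= u -> u <= p.2 -> h u 0 0 < z.1,
      forall u, p.1 <= u -> u <= p.2 -> z.2 < h u 0 1 |
      forall u, p.1 <= u -> u <= p.2 -> h u 0 1 < z.2].
Proof.
move=> hK QQ off p pQ; have := off p pQ.
have [p0 pp p1] := itv_partition_zip QQ pQ.
have near_corner i u : p.1 <= u -> u <= p.2 ->
    `|h u 0 i - h p.1 0 i| <= K * cpow w r p.1 p.2.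
  move=> pu up; apply: le_trans (hK i _ _ p0 pu (le_trans up p1)) _.
  by rewrite ler_wpM2l // (cpow_le wP r_gt).
have sides (c d e : R) : ~~ (`|d - c| <= e) -> d < c - e \/ c + e < d.
  rewrite -ltNge; case: (ltP d (c - e)) => [|cd]; first by left.
  case: (ltP (c + e) d) => [|dc]; first by right.
  by rewrite ltNge ler_distl cd dc.
move=> /nandP[] /sides[H|H].
- by apply: Or41 => u pu up;
  have := near_corner 0 u pu up; rewrite ler_distl; lra.
- by apply: Or42 => u pu up;
  have := near_corner 0 u pu up; rewrite ler_distl; lra.
- by apply: Or43 => u pu up;
  have := near_corner 1 u pu up; rewrite ler_distl; lra.
- by apply: Or44 => u pu up;
  have := near_corner 1 u pu up; rewrite ler_distl; lra.
Qed.
End BoxHalfPlanes.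

Theorem corollary2 (R : realType) (p : R) (g g' : R -> 'rV[R]_2)
    (p_ge1 : 1 <= p) (p_lt2 : p < 2)
    (g_cont : {within `[0, 1], continuous g})
    (g'_cont : {within `[0, 1], continuous g'})
    (g_closed : g 0 = g 1) (g'_closed : g' 0 = g' 1)
    (g_pvar : finite_pvariation p g 0 1)
    (g'_pvar : finite_pvariation p g' 0 1)
    (same_winding : forall z : 'rV[R]_2,
       ~ (translate_to_0 g @` `[0, 1]) z ->
       ~ (translate_to_0 g' @` `[0, 1]) z ->
       winding_number (translate_to_0 g) z =
       winding_number (translate_to_0 g') z)
    (n : nat) (n_range : (1 <= n <= 4)%N) :
  tcomponent n (tlog (signature g)) = tcomponent n (tlog (signature g')).
Proof.
have [w0 [w0P g0H]] := pvariation_control p_ge1 p_lt2 g_cont g_pvar.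
have [w1 [w1P g1H]] := pvariation_control p_ge1 p_lt2 g'_cont g'_pvar.
set r := ((p + 2) / 2)^-1 in g0H g1H.
have r_gt : 2^-1 < r by rewrite /r ltf_pV2 ?posrE; lra.
have r_ge0 : 0 <= r by move: r_gt; lra.
pose w s t := w0 s t + w1 s t.
have wP : control w by exact: controlD.
have gH i : holder w r (fun u => g u 0 i).
  apply: (holder_control_le r_ge0 w0P _ (g0H i)) => s t *.
  by rewrite lerDl; case: w1P => + _ _; apply.
have g'H i : holder w r (fun u => g' u 0 i).
  apply: (holder_control_le r_ge0 w1P _ (g1H i)) => s t *.
  by rewrite lerDr; case: w0P => + _ _; apply.
pose h := translate_to_0 g; pose h' := translate_to_0 g'.
have hE i u : h u 0 i = g u 0 i - g 0 0 i by rewrite /h /translate_to_0 !mxE.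
have h'E i u : h' u 0 i = g' u 0 i - g' 0 0 i.
  by rewrite /h' /translate_to_0 !mxE.
have h_cont : {within `[0, 1], continuous h}.
  by apply: (within_continuousB g_cont) => u; exact: cvg_cst.
have h'_cont : {within `[0, 1], continuous h'}.
  by apply: (within_continuousB g'_cont) => u; exact: cvg_cst.
have h_closed : h 0 = h 1 by rewrite /h /translate_to_0 g_closed.
have h'_closed : h' 0 = h' 1 by rewrite /h' /translate_to_0 g'_closed.
(* One constant for all four coordinates, so that both curves have boxes of the same size;
   translation does not affect it. *)
have [K K0 [hK h'K]] : exists2 K, 0 <= K &
    (forall i, holder_by w r K (fun u => h u 0 i)) /\
    (forall i, holder_by w r K (fun u => h' u 0 i)).
  have [K1 K10 H1] := gH 0; have [K2 K20 H2] := gH 1.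
  have [K3 K30 H3] := g'H 0; have [K4 K40 H4] := g'H 1.
  exists (K1 + K2 + K3 + K4); first by rewrite !addr_ge0.
  have sub (f : R -> R) c L : 0 <= L -> L <= K1 + K2 + K3 + K4 ->
      (forall s t, 0 <= s -> s <= t -> t <= 1 ->
        `|f t - f s| <= L * cpow w r s t) ->
      forall s t, 0 <= s -> s <= t -> t <= 1 ->
      `|f t - c - (f s - c)| <= (K1 + K2 + K3 + K4) * cpow w r s t.
    move=> L0 LK fL s t s0 st t1.
    have -> : f t - c - (f s - c) = f t - f s by ring.
    apply: le_trans (fL _ _ s0 st t1) _.
    by rewrite ler_wpM2r // cpow_ge0.
  split=> i s t s0 st t1; rewrite ?hE ?h'E; case: (ord2P i) => ->.
  - by apply: (sub (fun u => g u 0 0) _ K1) => //; lra.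
  - by apply: (sub (fun u => g u 0 1) _ K2) => //; lra.
  - by apply: (sub (fun u => g' u 0 0) _ K3) => //; lra.
  - by apply: (sub (fun u => g' u 0 1) _ K4) => //; lra.
have same_crossing Q z : itv_partition 0 1 Q ->
    (forall c, c \in zip (0 :: Q) Q ->
      ~~ in_box w r K (fun u => h u 0 0) (fun u => h u 0 1) c z) ->
    (forall c, c \in zip (0 :: Q) Q ->
      ~~ in_box w r K (fun u => h' u 0 0) (fun u => h' u 0 1) c z) ->
    psum (crossing (fun u => h u 0 0) (fun u => h u 0 1)) 0 Q z =
    psum (crossing (fun u => h' u 0 0) (fun u => h' u 0 1)) 0 Q z.
  move=> QQ /(off_box_half_planes wP r_gt K0 hK QQ) off.
  move=> /(off_box_half_planes wP r_gt K0 h'K QQ) off'.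
  rewrite -(winding_crossing h_cont h_closed QQ off).
  rewrite -(winding_crossing h'_cont h'_closed QQ off').
  apply: same_winding; first exact: (half_planes_off_image QQ off).
  exact: (half_planes_off_image QQ off').
pose s := iterated_integral g ^~ 1; pose s' := iterated_integral g' ^~ 1.
have moments a b :
    \sum_(x <- shuffle (nseq a.+1 0) (nseq b 1)) s (1 :: x) =
    \sum_(x <- shuffle (nseq a.+1 0) (nseq b 1)) s' (1 :: x).
  have [I [IP <-]] := shuffle_moment wP r_gt gH a.+1 b.
  have [I' [I'P <-]] := shuffle_moment wP r_gt g'H a.+1 b.
  pose F v : R := v ^+ a.+1 * (a.+1`!%:R)^-1.
  pose G v : R := v ^+ b.+1 * (b.+1`!%:R)^-1.
  apply: (same_moments wP r_gt K0 (hK 0) (hK 1) (h'K 0) (h'K 1) _ _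
    same_crossing (F := F) (G := G)).
  - by rewrite h_closed.
  - by rewrite h'_closed.
  - exact: locally_lipschitz_pow.
  - exact: locally_lipschitz_pow.
  - by apply: (eq_young_primitive _ _ _ IP) => // t _ _; rewrite /= hE.
  - by apply: (eq_young_primitive _ _ _ I'P) => // t _ _; rewrite /= h'E.
have agree v : (size v <= 4)%N -> signature g v = signature g' v.
  (* [signature] evaluates at the reversed word, so [low_degrees] is applied to [rev v]. *)
  rewrite /signature -(size_rev v) => v4.
  apply: (low_degrees (s := s) (s' := s')) v4 => // [u u'|u u'|i|i].
  - exact: (shuffle_product wP r_gt gH).
  - exact: (shuffle_product wP r_gt g'H).
  - by rewrite /s (iterated_integral1 wP r_gt gH) // g_closed subrr.
  - by rewrite /s' (iterated_integral1 wP r_gt g'H) // g'_closed subrr.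
apply/ffunP => v; rewrite !ffunE; apply: (tlog_agree agree).
by rewrite size_tuple; case/andP: n_range.
Qed.
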